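(* Let $X$ be a real Banach space with single-valued normalized duality mapping $J:X\to X^*$, let $N\ge 1$, let $A_1,\dots,A_N:X\to X$ be operators whose common zero set $S=\{x\in X: A_i(x)=0,\ i=1,\dots,N\}$ is nonempty, and let $\varphi$ be a function such that at least one of the following two sets of conditions holds. (A) Every $A_i$ is $\varphi$-inverse uniformly accretive (with the same $\varphi$); $J$ is sequentially weakly continuous and continuous; $X$ is smooth and reflexive and possesses the approximation. (B) Every $A_i$ is $m$-accretive and $\varphi$-inverse uniformly accretive (with the same $\varphi$); $X$ is uniformly smooth and uniformly convex. Let $\widehat{x}^*$ be the unique element of $S$ satisfying $\langle \widehat{x}^*, J(\widehat{x}^*-x^* )\rangle\le 0$ for all $x^*\in S$. Let $\{\alpha_n\}_{n\ge 0}$, $\{\gamma_n\}_{n\ge0}$ be sequences of positive real numbers such that (i) $\alpha_n\to 0$ and $\gamma_n\to+\infty$ as $n\to+\infty$; (ii) $\dfrac{\gamma_n|\alpha_{n+1}-\alpha_n|}{\alpha_n^2}\to 0$ as $n\to+\infty$, and $\sum_{n=1}^\infty \dfrac{\alpha_n}{\gamma_n}=+\infty$; (iii) $\dfrac{h_X(\tau_n)\,\varphi_R^{-1}(R_1\alpha_n)}{\alpha_n}\to 0$ as $n\to+\infty$, where $\tau_n=\gamma_n^{-1}$, $R>0$ is a fixed number with $R\ge 2\|\widehat{x}^*\|$, and $R_1=\frac{3R^2}{2}$. Assume in addition that for every fixed $s>0$ one has $\dfrac{\varphi(s,t)}{t}\to+\infty$ as $t\to+\infty$. Then, for arbitrary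 $x_0\in X$, the sequence $\{x_n\}$ defined for $n=0,1,2,\dots$ by $$A_i(x_n^i)+\Big(\frac{\alpha_n}{N}+\gamma_n\Big)x_n^i=\gamma_n x_n,\quad i=1,\dots,N,\qquad x_{n+1}=\frac1N\sum_{i=1}^N x_n^i,$$ converges strongly to $\widehat{x}^*$.
   Context: The normalized duality mapping $J:X\to X^*$ satisfies $\langle x,J(x)\rangle=\|x\|^2=\|J(x)\|^2$ for all $x\in X$; it is assumed single valued. An operator $A:X\to X$ is accretive if $\langle A(x)-A(y),J(x-y)\rangle\ge 0$ for all $x,y\in X$; it is $m$-accretive if it is accretive and the range of $A+\alpha I$ is $X$ for all $\alpha>0$. A continuous operator $A:X\to X$ is $\varphi$-inverse uniformly accretive if $\varphi:(0,\infty)\times[0,\infty)\to[0,\infty)$ is continuous and strictly increasing in the second variable, $\varphi(s,t)=0$ if and only if $t=0$ for every fixed $s>0$, and $$\langle A(x)-A(y),J(x-y)\rangle\ge \varphi(R,\|A(x)-A(y)\|)\quad\text{for all } R>0 \text{ and all } x,y\in X \text{ with } \|x\|,\|y\|\le R.$$ For fixed $s>0$, $\varphi_s^{-1}$ denotes the inverse function of $t\mapsto\varphi(s,t)$. $X$ possesses the approximation if there is a directed family of finite-dimensional subspaces $X_n$ ordered by inclusion, with corresponding projectors $P_n:X\to X_n$, such that $\|P_n\|=1$ for all $n\ge 0$ and $\bigcup_n X_n$ is dense in $X$. The modulus of smoothness is $\rho_X(\tau)=\sup\{\frac{\|x+y\|+\|x-y\|}{2}-1:\|x\|=1,\|y\|=\tau\}$,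 and $h_X(\tau)=\rho_X(\tau)/\tau$. $X$ is uniformly smooth if $h_X(\tau)\to 0$ as $\tau\to 0$. *)

(* Defs.v *)
From HB Require Import structures.
From mathcomp Require Import all_boot all_order all_algebra.
From mathcomp Require Import all_classical all_reals all_analysis.
Set Implicit Arguments.
Unset Strict Implicit.
Unset Printing Implicit Defensive.
Import Order.TTheory GRing.Theory Num.Theory.
Import numFieldNormedType.Exports.
Local Open Scope classical_set_scope.
Local Open Scope ring_scope.

Section Dual.
Context {R : realType} (V : normedModType R).

Definition dual_pred : {pred V -> R} :=
  mem [set f : V -> R | linear f /\ continuous f].

Record dual_space := DualSpace { dual_fun :> V -> R; _ : dual_fun \in dual_pred }.

HB.instance Definition _ := [isSub for dual_fun].
HB.instance Definition _ := [Choice of dual_space by <:].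

Lemma dualP (f : dual_space) : linear f /\ continuous f.
Proof. by case: f => f /= fP; rewrite inE in fP. Qed.

Fact dual_submod_closed : submod_closed dual_pred.
Proof.
split.
  rewrite inE; split; last exact: cst_continuous.
  by move=> a x y; rewrite -[RHS]/(a *: 0 + 0 : R) scaler0 addr0.
move=> a f g; rewrite !inE => -[fl fc] [gl gc]; split.
  move=> b x y; rewrite !fctE fl gl /GRing.scale/=.
  by rewrite !mulrDr !mulrA (mulrC a b) addrACA.
move=> x; apply: (@cvgD _ _ _ _ _ (a *: f) g) => //; last exact: gc.
by apply: cvgZl_tmp; exact: fc.
Qed.

HB.instance Definition _ := GRing.isSubmodClosed.Build _ _ dual_pred
  dual_submod_closed.
HB.instance Definition _ := [SubChoice_isSubLmodule of dual_space by <:].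

HB.instance Definition _ (f : dual_space) := GRing.isLinear.Build R V R _
  (f : V -> R) (dualP f).1.

Definition dual_norm (f : dual_space) : R :=
  sup [set `|f x| | x in [set x : V | `|x| <= 1]].

Lemma dual_norm_has_sup (f : dual_space) :
  has_sup [set `|f x| | x in [set x : V | `|x| <= 1]].
Proof.
split; first by exists `|f 0|, 0 => //=; rewrite normr0.
have /linear_bounded_continuous/bounded_funP/(_ 1)[M fM] :
  continuous (f : {linear V -> R}) := (dualP f).2.
by exists M => _ [x x1 <-]; exact: fM.
Qed.

Lemma dual_norm_ub (f : dual_space) (x : V) : `|x| <= 1 -> `|f x| <= dual_norm f.
Proof.
move=> x1; have [_ fu] := dual_norm_has_sup f.
by apply: ub_le_sup => //; exists x.
Qed.

Lemma dual_norm_le (f : dual_space) (M : R) :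
  (forall x, `|x| <= 1 -> `|f x| <= M) -> dual_norm f <= M.
Proof.
move=> fM; have [f0 _] := dual_norm_has_sup f.
by apply: ge_sup => // _ [x x1 <-]; exact: fM.
Qed.

Fact dual_normD f g : dual_norm (f + g) <= dual_norm f + dual_norm g.
Proof.
apply: dual_norm_le => x x1.
by rewrite (le_trans (ler_normD _ _))// lerD// dual_norm_ub.
Qed.

Fact dual_normZ a f : dual_norm (a *: f) = `|a| * dual_norm f.
Proof.
have le b g : dual_norm (b *: g) <= `|b| * dual_norm g.
  apply: dual_norm_le => x x1.
  by rewrite [X in `|X|](_ : _ = b * g x)// normrM ler_wpM2l// dual_norm_ub.
apply/eqP; rewrite eq_le le/=.
have [->|a0] := eqVneq a 0.
  rewrite normr0 mul0r; apply: le_trans (@dual_norm_ub _ 0 _) => //.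
  by rewrite normr0.
rewrite -ler_pdivlMl ?normr_gt0// -normfV.
by rewrite -[in leLHS](scalerK a0 f); exact: le.
Qed.

Fact dual_norm0_eq0 f : dual_norm f = 0 -> f = 0.
Proof.
move=> f0; apply/val_inj/funext => x /=.
have [->|x0] := eqVneq x 0; first by rewrite linear0.
have n0 : `|x| != 0 by rewrite normr_eq0.
have := @dual_norm_ub f (`|x|^-1 *: x).
rewrite normrZ normfV normr_id mulVf// => /(_ (lexx _)).
rewrite f0 normr_le0 linearZ/= scaler_eq0 invr_eq0 (negPf n0)/=.
by move=> /eqP.
Qed.

HB.instance Definition _ := Lmodule_isNormed.Build R dual_space
  dual_normD dual_normZ dual_norm0_eq0.

End Dual.

Section Geometry.
Context {R : realType}.

Definition weak_cvg (V : normedModType R) (u : nat -> V) (l : V) : Prop :=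
  forall f : dual_space V, f (u n) @[n --> \oo] --> f l.

(* Weak to weak: when W is itself a dual space, weak convergence in W is tested
   against the bidual. *)
Definition weakly_seq_continuous (V W : normedModType R) (F : V -> W) : Prop :=
  forall (u : nat -> V) (l : V), weak_cvg u l -> weak_cvg (F \o u) (F l).

Context (X : normedModType R).

Definition reflexive_space : Prop :=
  forall Phi : dual_space (dual_space X),
    exists x : X, forall f : dual_space X, Phi f = f x.

Definition smooth_space : Prop :=
  forall x : X, `|x| = 1 -> exists! f : dual_space X, `|f| = 1 /\ f x = 1.

Definition uniformly_convex : Prop :=
  forall eps : R, 0 < eps <= 2 -> exists2 delta : R, 0 < delta &
    forall x y : X, `|x| = 1 -> `|y| = 1 -> eps <= `|x - y| ->
      `|x + y| / 2 <= 1 - delta.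

Definition modulus_smoothness (tau : R) : R :=
  sup [set (`|p.1 + p.2| + `|p.1 - p.2|) / 2 - 1
      | p in [set p : X * X | `|p.1| = 1 /\ `|p.2| = tau]].

Definition h_smoothness (tau : R) : R := modulus_smoothness tau / tau.

Definition uniformly_smooth : Prop := h_smoothness tau @[tau --> 0^'+] --> 0.

Definition finite_dimensional (E : set X) : Prop :=
  exists (d : nat) (b : 'I_d -> X),
    E = [set \sum_(i < d) c i *: b i | c in [set: 'I_d -> R]].

(* Only meaningful for bounded P: sup is 0 on unbounded sets. *)
Definition operator_norm (P : X -> X) : R :=
  sup [set `|P x| | x in [set x : X | `|x| <= 1]].

Definition projector_onto (E : set X) (P : X -> X) : Prop :=
  [/\ linear P, continuous P, forall x, E (P x) & forall x, E x -> P x = x].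

(* The family is indexed by the natural numbers, and its directedness for
   inclusion does not presuppose that it is increasing. *)
Definition possesses_approximation : Prop :=
  exists (E : nat -> set X) (P : nat -> X -> X),
    [/\ forall n, finite_dimensional (E n),
        forall m n, exists k, E m `<=` E k /\ E n `<=` E k,
        forall n, projector_onto (E n) (P n),
        forall n, operator_norm (P n) = 1 &
        dense (\bigcup_n E n)].

End Geometry.

Section Operators.
Context {R : realType} {X : normedModType R}.

Definition duality_set (x : X) : set (dual_space X) :=
  [set f : dual_space X | f x = `|x| ^+ 2 /\ `|f| ^+ 2 = `|x| ^+ 2].

(* J is the normalized duality mapping, and that mapping is single valued. *)
Definition single_valued_duality (J : X -> dual_space X) : Prop :=
  forall x, duality_set x = [set J x].

Definition accretive (J : X -> dual_space X) (A : X -> X) : Prop :=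
  forall x y, 0 <= J (x - y) (A x - A y).

Definition m_accretive (J : X -> dual_space X) (A : X -> X) : Prop :=
  accretive J A /\
  forall alpha : R, 0 < alpha -> forall y, exists x, A x + alpha *: x = y.

(* phi stands for a map (0, oo) x [0, oo) -> [0, oo); its values outside this
   domain are irrelevant. *)
Definition modulus_function (phi : R -> R -> R) : Prop :=
  [/\ {within [set p : R * R | 0 < p.1 /\ 0 <= p.2],
         continuous (fun p : R * R => phi p.1 p.2)},
      forall s t, 0 < s -> 0 <= t -> 0 <= phi s t,
      forall s t u, 0 < s -> 0 <= t -> t < u -> phi s t < phi s u &
      forall s t, 0 < s -> 0 <= t -> (phi s t = 0 <-> t = 0)].

Definition inverse_uniformly_accretive (J : X -> dual_space X)
    (phi : R -> R -> R) (A : X -> X) : Prop :=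
  [/\ continuous A, modulus_function phi &
      forall (r : R) (x y : X), 0 < r -> `|x| <= r -> `|y| <= r ->
        phi r `|A x - A y| <= J (x - y) (A x - A y)].

(* The inverse of t |-> phi s t on [0, oo), with the junk value 0 outside the
   range. *)
Definition phi_inv (phi : R -> R -> R) (s y : R) : R :=
  xget 0 [set t | 0 <= t /\ phi s t = y].

Definition common_zeros (N : nat) (A : 'I_N -> X -> X) : set X :=
  [set x | forall i, A i x = 0].

(* y n i is the inner iterate x_n^i. *)
Definition iteration (N : nat) (A : 'I_N -> X -> X) (alpha gamma : nat -> R)
    (x0 : X) (x : nat -> X) : Prop :=
  x 0%N = x0 /\
  exists y : nat -> 'I_N -> X, forall n,
    (forall i, A i (y n i) + (alpha n / N%:R + gamma n) *: y n i
               = gamma n *: x n) /\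
    x n.+1 = N%:R^-1 *: \sum_(i < N) y n i.

End Operators.

(* Main.v *)
Require Import Defs.
From HB Require Import structures.
From mathcomp Require Import all_boot all_order all_algebra.
From mathcomp Require Import all_classical all_reals all_analysis.
From mathcomp Require Import ring lra.
Set Implicit Arguments.
Unset Strict Implicit.
Unset Printing Implicit Defensive.
Import Order.TTheory GRing.Theory Num.Theory.
Import numFieldNormedType.Exports.
Local Open Scope classical_set_scope.
Local Open Scope ring_scope.

(** The scheme follows the regularized path, formed by the solutions z n of
      A_1 z + ... + A_N z + alpha n z = 0,
    and the path converges to xhat.

    Solvability.  Since phi s t / t tends to infinity, the operators A_i, and
    hence their sum, are bounded and uniformly continuous on balls
    (inverse_uniformly_accretive_tame).  An operator of this kind which is
    strongly accretive has a zero in any Banach space (expansive_zero): the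
    explicit Euler scheme, compared with its own shift in time, produces
    approximate zeros.  This gives the iterates x_n^i and the points z n,
    whichever of the two sets of hypotheses holds.

    Convergence of the path.  For a common zero w, accretivity gives
    J (z n - w) (z n) <= 0, hence `|z n - w| ^+ 2 <= J (z n - w) (- w); moreover
    every A_i (z n) tends to 0, with norm at most phi_inv phi r (3 r^2 / 2 alpha n).
    When J is weakly continuous and X reflexive, a weak limit point of the path
    exists by weak sequential compactness (weakly_convergent_subsequence), is a
    common zero by demiclosedness (demiclosed_zero), and is a strong limit by
    the inequality above.  When X is uniformly convex and uniformly smooth, the
    path has an asymptotic center (asymptotic_center), which is a common zero;
    its radius is 0 because uniform smoothness would otherwise allow a smaller
    one (smooth_center_attained).  In both cases the limit satisfies the
    inequality that characterizes xhat.

    Following the path.  Write tau = 1 / gamma n and u = x_n - z n.  Each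
    resolvent gives (1 + tau alpha n / N) `|x_n^i - z n| <= `|u - tau b_i|, where
    b_i = A_i (z n) + (alpha n / N) z n.  The b_i sum to 0.  Hence, when
    `|u| >= delta, averaging cancels the first order terms of the norms, and
    what remains is a smoothness error of order tau h(tau) phi_inv, that is
    o(tau alpha n) by hsmooth (proximal_step_smooth).  The path itself moves by
    o(tau alpha n) by hdiff.  So at distance delta or more the distance to the
    path decreases by a fixed multiple of tau alpha n, and the series of these
    terms diverges (cvg0_of_drift). *)

(** * The duality mapping *)

Section DualityMapping.
Context {R : realType} {X : normedModType R}.

Lemma dual_apply_le (f : dual_space X) (x : X) : `|f x| <= `|f| * `|x|.
Proof.
have [->|x0] := eqVneq x 0; first by rewrite linear0 !normr0 mulr0.
have n0 : 0 < `|x| by rewrite normr_gt0.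
have : `|f (`|x|^-1 *: x)| <= `|f|.
  by apply: dual_norm_ub; rewrite normrZ normfV normr_id mulVf ?gt_eqF.
by rewrite linearZ /= normrM normfV normr_id ler_pdivrMl // mulrC.
Qed.

Lemma dualZ (f : dual_space X) (a : R) (x : X) : f (a *: x) = a * f x.
Proof. by rewrite linearZ. Qed.

Context (J : X -> dual_space X) (hJ : single_valued_duality J).

Lemma J_self x : J x x = `|x| ^+ 2.
Proof. by have [] : duality_set x (J x) by rewrite (hJ x). Qed.

Lemma J_norm x : `|J x| = `|x|.
Proof.
have [_ /eqP] : duality_set x (J x) by rewrite (hJ x).
by rewrite eqrXn2 // => /eqP.
Qed.

Lemma J_le x y : J x y <= `|x| * `|y|.
Proof.
by rewrite (le_trans (ler_norm _)) // (le_trans (dual_apply_le _ _)) // J_norm.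
Qed.

(** The way the duality mapping is used throughout: testing u + l v against
    J u turns a lower bound on the pairing J u v into an estimate between norms,
    in which J no longer occurs. *)
Lemma strongly_accretive_expansive (a l : R) (u v : X) :
  0 <= l -> a * `|u| ^+ 2 <= J u v -> (1 + l * a) * `|u| <= `|u + l *: v|.
Proof.
move=> l0 Juv; have [->|u0] := eqVneq u 0; first by rewrite normr0 mulr0.
have n0 : 0 < `|u| by rewrite normr_gt0.
rewrite -(ler_pM2l n0); apply: le_trans (J_le _ _).
rewrite linearD linearZ /= J_self mulrCA -expr2 mulrDl mul1r lerD2l -mulrA.
exact: ler_wpM2l.
Qed.

End DualityMapping.

(** * Zeros of strongly accretive operators *)

Lemma subrACA (V : zmodType) (x y z t : V) : (x - y) - (z - t) = (x - z) - (y - t).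
Proof. by rewrite !opprB addrACA [RHS]addrACA [- z - y]addrC. Qed.

(** While d stays above c + eta, each step lowers it by at least q eta, so it
    cannot stay there. *)
Lemma drift_below {R : realType} (d : nat -> R) (q c eta : R) :
  0 < q -> 0 < eta -> (forall k, 0 <= d k) ->
  (forall k, (1 + q) * d k.+1 <= d k + q * c) -> exists k, d k <= c + eta.
Proof.
move=> q0 eta0 d0 dS; apply: contrapT => /forallNP far.
have lt k : c + eta < d k by rewrite ltNge; apply/negP/far.
have le k : d k <= d 0%N - (q * eta) *+ k.
  elim: k => [|k IH]; first by rewrite mulr0n subr0.
  have := dS k; have := lt k.+1; rewrite -(ltr_pM2l q0) mulrSr; lra.
have qe : 0 < q * eta by rewrite mulr_gt0.
have := archi_boundP (divr_ge0 (d0 0%N) (ltW qe)).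
set n := Num.bound _; rewrite ltr_pdivrMr // mulr_natl.
by have := le n; have := d0 n; lra.
Qed.

Section ExpansiveZero.
Context {R : realType} {X : completeNormedModType R}.
Context (F : X -> X) (a : R) (a0 : 0 < a).
Hypothesis expansive : forall (x y : X) (l : R), 0 <= l ->
  (1 + l * a) * `|x - y| <= `|x - y + l *: (F x - F y)|.
Hypothesis bounded : forall rho : R, exists2 M : R, 0 < M &
  forall x, `|x| <= rho -> `|F x| <= M.
Hypothesis uniform : forall rho eps : R, 0 < eps -> exists2 delta : R, 0 < delta &
  forall x y, `|x| <= rho -> `|y| <= rho -> `|x - y| <= delta ->
    `|F x - F y| <= eps.

Lemma expansive_dist x y : a * `|x - y| <= `|F x - F y|.
Proof.
have := expansive x y ler01; rewrite mul1r scale1r mulrDl mul1r => le.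
have := ler_normD (x - y) (F x - F y); lra.
Qed.

(** The explicit Euler iterates x k of the equation x' = - F x, with step
    mu = h / p, stay in a ball, and a step is an implicit one up to an error e1
    in F.  Expansiveness contracts the distance between the trajectory and its
    shift by p steps, that is by the time h, up to 2 e1 / a.  Over that time F
    barely varies, so the same distance is about h `|F (x k)|; hence F (x k) is
    small.  The order of choices matters: h controls the variation of F and is
    fixed first, and e1 must be small relative to h. *)
Lemma expansive_approximate_zero (eta : R) : 0 < eta -> exists x, `|F x| <= eta.
Proof.
move=> eta0; pose rho : R := (`|F 0| + 1) / a.
have rho0 : 0 <= rho by rewrite divr_ge0 ?addr_ge0 // ltW.
have [M M0 FM] := bounded rho.
have e20 : 0 < eta / 2 by lra.
have [d2 d20 Fd2] := uniform (rho + 1) e20.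
pose h : R := Num.min 1 (d2 / M).
have h0 : 0 < h by rewrite lt_min ltr01 divr_gt0.
have hM : h * M <= d2 by rewrite -ler_pdivlMr // ge_min lexx orbT.
pose e1 : R := Num.min 1 (a * (h * eta) / 6).
have e10 : 0 < e1 by rewrite lt_min ltr01 divr_gt0 // !mulr_gt0.
have [d1 d10 Fd1] := uniform (rho + 1) e10.
(* The number p of steps is taken so large that one step moves x by at most
   both 1, which keeps the iterates in the ball of radius rho + 1, and d1. *)
pose p := (Num.bound (Num.max (h * M) (h * M / d1))).+1.
have hM0 : 0 <= h * M by rewrite mulr_ge0 ?ltW.
have p0 : 0 < p%:R :> R by rewrite ltr0n.
have ltp : Num.max (h * M) (h * M / d1) < p%:R.
  apply: lt_trans (archi_boundP _) _; first by rewrite le_max hM0.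
  by rewrite ltr_nat.
have [mu muE] : exists mu : R, mu = h / p%:R by eexists.
have mu0 : 0 < mu by rewrite muE divr_gt0.
have muM (c : R) : 0 < c -> h * M / c < p%:R -> mu * M <= c.
  by move=> c0 ltc; rewrite muE mulrAC ler_pdivrMr // [c * _]mulrC -ler_pdivrMr // ltW.
have muM1 : mu * M <= 1.
  by apply: muM => //; rewrite divr1; apply: le_lt_trans ltp; rewrite le_max lexx.
have muMd : mu * M <= d1.
  by apply: muM => //; apply: le_lt_trans ltp; rewrite le_max lexx orbT.
have [x [x00 xS]] : exists x : nat -> X, x 0%N = 0 /\
    forall k, x k.+1 = x k - mu *: F (x k).
  by exists (fun k => iter k (fun z => z - mu *: F z) 0).
have step k : `|x k| <= rho -> `|x k - x k.+1| <= mu * M.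
  move=> xk; rewrite xS opprB addrC subrK normrZ (gtr0_norm mu0).
  rewrite (ler_wpM2l (ltW mu0)) //.
  exact: FM.
have resid k : `|x k| <= rho -> `|F (x k) - F (x k.+1)| <= e1.
  move=> xk; have st := step k xk.
  apply: Fd1; [lra| |lra].
  by have := ler_normB (x k) (x k - x k.+1); rewrite subKr; lra.
have implicit k : x k.+1 + mu *: F (x k.+1) = x k - mu *: (F (x k) - F (x k.+1)).
  by rewrite xS scalerBr opprB addrA addrAC.
have xrho k : `|x k| <= rho.
  elim: k => [|k IH]; first by rewrite x00 normr0.
  have := expansive (x k.+1) 0 (ltW mu0).
  rewrite !subr0 scalerBr addrA implicit => le.
  have := ler_normB (x k - mu *: (F (x k) - F (x k.+1))) (mu *: F 0).
  have := ler_normB (x k) (mu *: (F (x k) - F (x k.+1))).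
  rewrite !normrZ (gtr0_norm mu0).
  have e11 : e1 <= 1 by rewrite ge_min lexx.
  have := ler_wpM2l (ltW mu0) (le_trans (resid k IH) e11).
  have ra : rho * a = `|F 0| + 1 by rewrite /rho divfK ?gt_eqF.
  have m1 : 0 < 1 + mu * a by rewrite addr_gt0 // mulr_gt0.
  move=> l1 l2 l3; rewrite -(ler_pM2l m1).
  have -> : (1 + mu * a) * rho = rho + mu * (`|F 0| + 1) by rewrite -ra; ring.
  lra.
have shift k : (1 + mu * a) * `|x (k.+1 + p)%N - x k.+1|
    <= `|x (k + p)%N - x k| + mu * a * (2 * e1 / a).
  have := expansive (x (k + p).+1) (x k.+1) (ltW mu0).
  rewrite scalerBr addrACA -opprD !implicit subrACA -scalerBr.
  move=> le; apply: le_trans le _.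
  apply: le_trans (ler_normB _ _) _; rewrite lerD2l normrZ gtr0_norm // -mulrA.
  rewrite (ler_wpM2l (ltW mu0)) // [a * _]mulrC divfK ?gt_eqF //.
  apply: le_trans (ler_normB _ _) _.
  by have := resid k (xrho k); have := resid _ (xrho (k + p)%N); lra.
have he0 : 0 < h * eta / 6 by rewrite divr_gt0 // mulr_gt0.
have [k dk] := drift_below (mulr_gt0 mu0 a0) he0 (fun k => normr_ge0 _) shift.
exists (x k); rewrite -(ler_pM2l h0).
have drift j : (j <= p)%N -> `|x k - x (j + k)%N| <= j%:R * (mu * M).
  elim: j => [|j IH] jp; first by rewrite subrr normr0 mul0r.
  have := ler_distD (x (j + k)%N) (x k) (x (j.+1 + k)%N).
  by have := IH (ltnW jp); have := step _ (xrho (j + k)%N); rewrite -natr1 addSn; lra.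
have hmu : h = p%:R * mu by rewrite muE mulrC divfK ?gt_eqF.
have sumF j : (j <= p)%N ->
    `|x (j + k)%N - x k + (j%:R * mu) *: F (x k)| <= j%:R * mu * (eta / 2).
  elim: j => [|j IH] jp.
    by rewrite add0n subrr !mul0r scale0r addr0 normr0.
  have -> : x (j.+1 + k)%N - x k + (j.+1%:R * mu) *: F (x k) =
      (x (j + k)%N - x k + (j%:R * mu) *: F (x k)) + mu *: (F (x k) - F (x (j + k)%N)).
    rewrite addSn xS -natr1 mulrDl mul1r scalerDl scalerBr.
    by rewrite -!addrA; congr (_ + _); rewrite addrC -!addrA; congr (_ + _);
       rewrite addrA.
  apply: le_trans (ler_normD _ _) _.
  have -> : j.+1%:R * mu * (eta / 2) = j%:R * mu * (eta / 2) + mu * (eta / 2).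
    by rewrite -natr1; ring.
  rewrite lerD ?IH ?(ltnW jp) // normrZ gtr0_norm // (ler_wpM2l (ltW mu0)) //.
  apply: Fd2; [have := xrho k; lra|have := xrho (j + k)%N; lra|].
  apply: le_trans (drift j (ltnW jp)) _; apply: le_trans hM.
  by rewrite mulrA hmu (ler_wpM2r (ltW M0)) // (ler_wpM2r (ltW mu0)) // ler_nat ltnW.
have := sumF p (leqnn p); rewrite -hmu addnC => le.
have := ler_normB (x (k + p)%N - x k + h *: F (x k)) (x (k + p)%N - x k).
rewrite addrAC subrr add0r normrZ gtr0_norm //.
have e1h : 2 * e1 / a <= h * eta / 3.
  rewrite ler_pdivrMr //.
  have : e1 <= a * (h * eta) / 6 by rewrite ge_min lexx orbT.
  by lra.
by lra.
Qed.

(** Expansiveness makes a sequence of approximate zeros a Cauchy sequence. *)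
Lemma expansive_zero : exists x, F x = 0.
Proof.
have /choice[x xF] (n : nat) : exists x, `|F x| <= n.+1%:R^-1.
  by apply: expansive_approximate_zero; rewrite invr_gt0 ltr0n.
have Fx0 : F (x n) @[n --> \oo] --> 0.
  apply/cvgr0Pnorm_le => e e0; near=> n; apply: le_trans (xF n) _; apply: ltW.
  near: n; exact: (near_infty_natSinv_lt (PosNum e0)).
have /cauchy_cvgP/cvg_ex[l xl] : cauchy (x @ \oo).
  apply/cauchy_exP => e e0.
  have ae0 : 0 < a * e / 2 by rewrite divr_gt0 // mulr_gt0.
  have [n _ nP] := (cvgr0Pnorm_lt _).1 Fx0 _ ae0.
  exists (x n); exists n => // m /= nm; rewrite -ball_normE /=.
  rewrite -(ltr_pM2l a0); apply: le_lt_trans (expansive_dist _ _) _.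
  apply: le_lt_trans (ler_normB _ _) _.
  by have := nP n (leqnn n); have := nP m nm => /=; lra.
exists l; apply/eqP; rewrite -normr_le0; apply/ler_addgt0Pr => e e0.
rewrite add0r; have [d d0 Fd] := uniform (`|l| + 1) (divr_gt0 e0 (ltr0Sn R 1)).
near \oo => n.
have xln : `|l - x n| <= Num.min d 1.
  by near: n; move/cvgrPdist_le: xl; apply; rewrite lt_min d0 ltr01.
have Fxn : `|F (x n)| <= e / 2.
  by near: n; move/cvgr0Pnorm_le: Fx0; apply; lra.
move: xln; rewrite le_min => /andP[xd x1].
have xn : `|x n| <= `|l| + 1 by have := ler_normB l (l - x n); rewrite subKr; lra.
have := Fd l (x n) _ xn xd; rewrite lerDl ler01 => /(_ isT).
by have := ler_normD (F l - F (x n)) (F (x n)); rewrite subrK; lra.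
Unshelve. all: by end_near. Qed.

End ExpansiveZero.

(** * Consequences of smoothness *)

Section Smoothness.
Context {R : realType} {X : normedModType R}.

Lemma modulus_smoothness_ub (x y : X) (tau : R) : `|x| = 1 -> `|y| = tau ->
  (`|x + y| + `|x - y|) / 2 - 1 <= modulus_smoothness X tau.
Proof.
move=> x1 yt; apply: ub_le_sup; last by exists (x, y).
exists tau => _ [[u v] /= [u1 vt] <-].
by have := ler_normD u v; have := ler_normB u v; rewrite u1 vt; lra.
Qed.

(** Along a fixed direction the symmetric second difference of the norm is
    convex and vanishes at 0, so its quotient by the length of the increment is
    monotone.  The bound therefore holds for all increments of relative size at
    most tau, with the same value h tau. *)
Lemma smoothness_sum_le (u y : X) (tau : R) : 0 < tau -> `|y| <= tau * `|u| ->
  `|u + y| + `|u - y| <= 2 * `|u| + 2 * `|y| * h_smoothness X tau.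
Proof.
move=> t0 yu; have [->|y0] := eqVneq y 0.
  by rewrite addr0 subr0 normr0 mulr0 mul0r addr0; lra.
have ny : 0 < `|y| by rewrite normr_gt0.
have nu : 0 < `|u| by rewrite -(pmulr_rgt0 _ t0); exact: lt_le_trans yu.
have [l lE] : exists l : R, l = `|y| / (tau * `|u|) by eexists.
have l0 : 0 <= l by rewrite lE divr_ge0 // mulr_ge0 // ltW.
have l1 : l <= 1 by rewrite lE ler_pdivrMr ?mulr_gt0 // mul1r.
have luE : l * `|u| = `|y| / tau by rewrite lE; field; rewrite !gt_eqF.
pose x := `|u|^-1 *: u; pose z := (tau / `|y|) *: y.
have x1 : `|x| = 1 by rewrite normrZ normfV normr_id mulVf ?gt_eqF.
have zt : `|z| = tau.
  by rewrite normrZ ger0_norm ?divr_ge0 ?(ltW t0) // divfK ?gt_eqF.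
have uxE : (l * `|u|) *: x = l *: u by rewrite scalerA mulfK ?gt_eqF.
have yzE : (l * `|u|) *: z = y.
  by rewrite luE scalerA mulrA divfK ?gt_eqF // mulfV ?gt_eqF // scale1r.
have dec (w v : X) : (l * `|u|) *: w = v ->
    `|u + v| <= (1 - l) * `|u| + l * `|u| * `|x + w|.
  move=> <-; have {1}-> : u = (1 - l) *: u + (l * `|u|) *: x.
    by rewrite uxE -scalerDl subrK scale1r.
  rewrite -addrA -scalerDr (le_trans (ler_normD _ _)) // !normrZ.
  have l10 : 0 <= 1 - l by rewrite subr_ge0.
  by rewrite normr_id (ger0_norm l0) (ger0_norm l10).
have := dec _ _ yzE; have := dec (- z) (- y); rewrite scalerN yzE => /(_ erefl).
have := modulus_smoothness_ub x1 zt.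
have lu0 : 0 <= l * `|u| by rewrite mulr_ge0.
have -> : 2 * `|y| * h_smoothness X tau = l * `|u| * (2 * modulus_smoothness X tau).
  by rewrite luE /h_smoothness; ring.
move=> m d1 d2; have := ler_wpM2l lu0 m; lra.
Qed.

Lemma h_smoothness_ge0 (u : X) (tau : R) : u != 0 -> 0 < tau ->
  0 <= h_smoothness X tau.
Proof.
move=> u0 t0; have nu : 0 < `|u| by rewrite normr_gt0.
have := @smoothness_sum_le u (tau *: u) tau t0.
rewrite normrZ gtr0_norm // => /(_ (lexx _)).
have := ler_normD (u + tau *: u) (u - tau *: u).
rewrite addrACA subrr addr0 -mulr2n normrMn -mulr_natl => l1 l2.
by rewrite -(pmulr_rge0 _ (_ : 0 < 2 * (tau * `|u|))) ?mulr_gt0 //; lra.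
Qed.

(** A first order expansion of the norm: it combines the previous bound with
    the subgradient inequality for u - y.  The error
    depends on u and y only through their norms. *)
Lemma smoothness_norm_le (J : X -> dual_space X) (u y : X) (tau : R) :
  single_valued_duality J -> u != 0 -> 0 < tau -> `|y| <= tau * `|u| ->
  `|u + y| <= `|u| + J u y / `|u| + 2 * `|y| * h_smoothness X tau.
Proof.
move=> hJ u0 t0 yu; have nu : 0 < `|u| by rewrite normr_gt0.
have := smoothness_sum_le t0 yu.
have : `|u| - J u y / `|u| <= `|u - y|.
  rewrite -(ler_pM2l nu) mulrBr [_ * (_ / _)]mulrC divfK ?gt_eqF //.
  by rewrite -expr2 -(J_self hJ) -linearB; exact: J_le.
by lra.
Qed.

End Smoothness.

(** * Asymptotic centers in uniformly convex spaces *)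

Definition eventually_within {R : realType} {X : normedModType R}
    (z : nat -> X) (c : R) (y : X) : Prop :=
  \forall n \near \oo, `|z n - y| <= c.

Section AsymptoticCenter.
Context {R : realType} {X : completeNormedModType R}.

(** Either one of the vectors lies well inside the ball, and then so does the
    midpoint, or both are close to their normalizations, to which the definition
    on the unit sphere applies. *)
Lemma uniformly_convex_ball (eps : R) : uniformly_convex X -> 0 < eps <= 2 ->
  exists2 delta : R, 0 < delta & forall (c : R) (x y : X), 0 < c ->
    `|x| <= c -> `|y| <= c -> eps * c <= `|x - y| ->
    `|x + y| / 2 <= c * (1 - delta).
Proof.
move=> uc /andP[e0 e2].
have [|dl dl0 dlP] := uc (eps / 2); first by lra.
pose eta := Num.min (eps / 4) (Num.min (dl / 2) (1 / 2)).
have [etae [etad eta1]] : eta <= eps / 4 /\ eta <= dl / 2 /\ eta <= 1 / 2.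
  by rewrite !ge_min !lexx /= !orbT.
have eta0 : 0 < eta by rewrite !lt_min; apply/and3P; split; lra.
clearbody eta.
exists (eta / 2); first by lra.
suff unit (x y : X) : `|x| <= 1 -> `|y| <= 1 -> eps <= `|x - y| ->
    `|x + y| / 2 <= 1 - eta / 2.
  move=> c x y c0 xc yc exy.
  have sc (v : X) : `|c^-1 *: v| = `|v| / c by rewrite normrZ normfV gtr0_norm // mulrC.
  have sc1 (v : X) : `|v| <= c -> `|c^-1 *: v| <= 1 by rewrite sc ler_pdivrMr // mul1r.
  have := unit _ _ (sc1 x xc) (sc1 y yc).
  rewrite -scalerBr -scalerDr !sc ler_pdivlMr // => /(_ exy).
  by rewrite mulrAC ler_pdivrMr // [c * _]mulrC.
move=> x1 y1 exy.
have [xs|xl] := leP `|x| (1 - eta); first by have := ler_normD x y; lra.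
have [ys|yl] := leP `|y| (1 - eta); first by have := ler_normD x y; lra.
have near_unit (v : X) : `|v| <= 1 -> 1 - eta < `|v| ->
    `| `|v|^-1 *: v| = 1 /\ `|v - `|v|^-1 *: v| <= eta.
  move=> v1 vl; have v0 : 0 < `|v| by lra.
  rewrite normrZ normfV normr_id mulVf ?gt_eqF //; split => //.
  rewrite -[X in X - _]scale1r -scalerBl normrZ -[X in _ * X]ger0_norm // -normrM.
  by rewrite mulrBl mul1r mulVf ?gt_eqF // ler0_norm; lra.
have [xn xd] := near_unit x x1 xl; have [yn yd] := near_unit y y1 yl.
set x' := _ *: x in xn xd; set y' := _ *: y in yn yd.
have := dlP x' y' xn yn.
have : `|x - y| <= `|x' - y'| + (`|x - x'| + `|y - y'|).
  have -> : x - y = (x' - y') + ((x - x') - (y - y')).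
    by rewrite [RHS]addrC subrACA subrK.
  by rewrite (le_trans (ler_normD _ _)) // lerD2l ler_normB.
have : `|x + y| <= `|x' + y'| + (`|x - x'| + `|y - y'|).
  have -> : x + y = (x' + y') + ((x - x') + (y - y')).
    by rewrite [RHS]addrC addrACA !subrK.
  by rewrite (le_trans (ler_normD _ _)) // lerD2l ler_normD.
move=> l1 l2; have exy' : eps / 2 <= `|x' - y'| by lra.
by move=> /(_ exy'); lra.
Qed.

(** The infimum d of the asymptotic radii is attained at a unique point: by
    uniform convexity, two points of asymptotic radius close to d are close to
    each other, for otherwise their midpoint would have a radius below d.  This
    gives uniqueness, and the Cauchy property of a minimizing sequence. *)
Lemma asymptotic_center (z : nat -> X) (M : R) : uniformly_convex X ->
  (forall n, `|z n| <= M) ->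
  exists (d : R) (y : X), [/\ 0 <= d,
    forall c w, eventually_within z c w -> d <= c,
    forall c, d < c -> eventually_within z c y &
    forall w, (forall c, d < c -> eventually_within z c w) -> w = y].
Proof.
move=> uc zM; pose D := [set c : R | exists y, eventually_within z c y].
have D0 c : D c -> 0 <= c.
  by move=> [y /filter_ex[n]]; apply: le_trans.
have hiD : has_inf D.
  split; last by exists 0 => c /D0.
  by exists M, 0; apply: nearW => n; rewrite subr0.
pose d := inf D.
have dle c w : eventually_within z c w -> d <= c.
  by move=> Qcw; apply: ge_inf; [exact: hiD.2|exists w].
have d0 : 0 <= d by apply: lb_le_inf => //; exact: hiD.1.
have cluster e : 0 < e -> exists2 c, d < c & forall y w,
    eventually_within z c y -> eventually_within z c w -> `|y - w| <= e.
  move=> e0; have := d0; rewrite le_eqVlt => /orP[/eqP d0'|dp].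
    exists (e / 2) => [|y w Qy Qw]; first by rewrite -d0'; lra.
    have [n [ny nw]] := filter_ex (filterI Qy Qw).
    by have := ler_distD (z n) y w; rewrite (distrC y (z n)); move: ny nw => /=; lra.
  pose eps := Num.min 2 (e / (2 * d)).
  have eps0 : 0 < eps <= 2.
    by rewrite lt_min ge_min lexx /= andbT ltr0Sn divr_gt0 // mulr_gt0.
  have [dl dl0 dlP] := uniformly_convex_ball uc eps0.
  pose c := d + Num.min d (d * dl / 2).
  have ddl : 0 < d * dl by rewrite mulr_gt0.
  have c2 : c <= 2 * d by rewrite mulr_natl mulr2n lerD2l ge_min lexx.
  have cdl : c <= d + d * dl / 2 by rewrite lerD2l ge_min lexx orbT.
  have cd : d < c by rewrite ltrDl lt_min dp /=; lra.
  have c0 : 0 < c by lra.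
  exists c => // y w Qy Qw; rewrite leNgt; apply/negP => eyw.
  have : d <= c * (1 - dl).
    apply: (dle _ (2^-1 *: (y + w))); near=> n.
    have := dlP c (z n - y) (z n - w) c0.
    have -> : (z n - y) + (z n - w) = 2 *: (z n - 2^-1 *: (y + w)).
      rewrite addrACA -opprD scalerBr scalerA mulfV // scale1r.
      by rewrite scaler_nat mulr2n.
    rewrite normrZ ger0_norm // mulrAC mulfV // mul1r; apply.
    + by near: n.
    + by near: n.
    + rewrite subrACA subrr sub0r opprB -distrC ltW // (le_lt_trans _ eyw) //.
      apply: le_trans (ler_wpM2l _ c2) _; first by lra.
      by rewrite mulrC -ler_pdivlMl ?mulr_gt0 // mulrC ge_min lexx orbT.
  have : d * dl < c * dl by rewrite ltr_pM2r.
  by lra.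
have /choice[y yP] (k : nat) : exists y, eventually_within z (d + k.+1%:R^-1) y.
  have k0 : 0 < k.+1%:R^-1 :> R by rewrite invr_gt0 ltr0n.
  have [c [w Qcw] ltc] := inf_adherent k0 hiD.
  by exists w; apply: filterS Qcw => n /le_trans; apply; exact: ltW.
have yQ c : d < c -> \forall k \near \oo, eventually_within z c (y k).
  move=> dc; have dc0 : 0 < c - d by rewrite subr_gt0.
  near=> k; apply: filterS (yP k) => n /le_trans; apply.
  rewrite -lerBrDl ltW //; near: k; exact: (near_infty_natSinv_lt (PosNum dc0)).
have /cauchy_cvgP/cvg_ex[l yl] : cauchy (y @ \oo).
  apply/cauchy_exP => e e0; have e20 : 0 < e / 2 by lra.
  have [c cd cP] := cluster _ e20; have [n _ nP] := yQ c cd.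
  exists (y n); exists n => // m /= nm; rewrite -ball_normE /=.
  have := cP _ _ (nP n (leqnn n)) (nP m nm); lra.
have lQ c : d < c -> eventually_within z c l.
  move=> dc; pose c' := (c + d) / 2.
  near \oo => k; have Q : eventually_within z c' (y k).
    by near: k; apply: yQ; rewrite /c'; lra.
  have ylk : `|l - y k| <= (c - d) / 2.
    by near: k; move/cvgrPdist_le: yl; apply; lra.
  apply: filterS Q => n; rewrite /c' => zn.
  by have := ler_distD (y k) (z n) l; rewrite (distrC (y k) l); lra.
exists d, l; split => // w wQ; apply/eqP; rewrite -subr_eq0 -normr_le0.
apply/ler_addgt0Pr => e e0; rewrite add0r.
by have [c cd cP] := cluster _ e0; apply: cP; [exact: wQ|exact: lQ].
Unshelve. all: by end_near. Qed.

End AsymptoticCenter.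

(** If the radius d were positive, moving the center y to y - t y would decrease
    it.  Indeed z n - y becomes z n - y + t y, and the hypothesis says that J
    pairs y with z n - y to at most - `|z n - y| ^+ 2, so that the norm shrinks
    by the factor 1 - t to first order; uniform smoothness makes the remainder
    uniform in n. *)
Lemma smooth_center_attained {R : realType} {X : normedModType R}
    (J : X -> dual_space X) (z : nat -> X) (d : R) (y : X) :
  single_valued_duality J -> uniformly_smooth X -> 0 <= d ->
  (forall c w, eventually_within z c w -> d <= c) ->
  (forall c, d < c -> eventually_within z c y) ->
  (forall n, `|z n - y| ^+ 2 <= J (z n - y) (- y)) -> d = 0.
Proof.
move=> hJ us d0 dmin yQ zy; apply/eqP; rewrite eq_le d0 andbT leNgt.
apply/negP => dp.
pose K := `|y| + 1; have K0 : 0 < K by rewrite ltr_wpDl.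
have e0 : 0 < d / (8 * K) by rewrite divr_gt0 ?mulr_gt0.
have [t0 t00 t0P] : exists2 t0 : R, 0 < t0 &
    forall tau, 0 < tau < t0 -> `|h_smoothness X tau| < d / (8 * K).
  have [t0 /= t00 t0P] := (cvgr0Pnorm_lt _).1 us _ e0.
  exists t0 => // tau /andP[tau0 taut]; apply: t0P => //=.
  by rewrite sub0r normrN gtr0_norm.
have [t [tp t1 tK tt]] : exists t : R,
    [/\ 0 < t, t <= 1, t * K <= d / 8 & 2 * (t * K) / d < t0].
  exists (Num.min 1 (Num.min (d / (8 * K)) (t0 * d / (4 * K)))); split.
  - by rewrite !lt_min ltr01 e0 divr_gt0 // mulr_gt0.
  - by rewrite ge_min lexx.
  - rewrite -ler_pdivlMr // (_ : d / 8 / K = d / (8 * K)); last first.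
      by field; rewrite gt_eqF.
    by rewrite !ge_min lexx orbT.
  - set t := Num.min _ _.
    have : t <= t0 * d / (4 * K) by rewrite !ge_min lexx !orbT.
    rewrite ler_pdivlMr ?mulr_gt0 // ltr_pdivrMr //.
    have : 0 < t0 * d by rewrite mulr_gt0.
    by lra.
have tau0 : 0 < 2 * (t * K) / d by rewrite divr_gt0 // !mulr_gt0.
have hd : h_smoothness X (2 * (t * K) / d) < d / (8 * K).
  by apply: le_lt_trans (ler_norm _) (t0P _ _); rewrite tau0.
have td : 0 < t * d by rewrite mulr_gt0.
suff : d <= d - t * d / 8 by lra.
apply: (dmin _ (y - t *: y)).
have : d < d + t * d / 8 by lra.
move=> /yQ; apply: filterS => n.
rewrite opprB addrA addrAC; move: (zy n); set u := z n - y => zu ud.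
have yK : `|t *: y| <= t * K.
  by rewrite normrZ gtr0_norm // ler_pM2l // lerDl.
have [us2|ul] := ltP `|u| (d / 2).
  have : t * d <= d by rewrite ger_pMl.
  by have := ler_normD u (t *: y); lra.
have nu : 0 < `|u| by lra.
have yu : `|t *: y| <= 2 * (t * K) / d * `|u|.
  apply: le_trans yK _; apply: le_trans (ler_wpM2l (ltW tau0) ul).
  by rewrite (_ : _ * (d / 2) = t * K) //; field; rewrite gt_eqF.
have u0 : u != 0 by rewrite -normr_gt0.
have := smoothness_norm_le hJ u0 tau0 yu.
have Ju : J u (t *: y) / `|u| <= - (t * `|u|).
  have Juy : J u y <= - `|u| ^+ 2 by rewrite lerNr -linearN.
  have JtE : J u (t *: y) = t * J u y by rewrite linearZ.
  rewrite ler_pdivrMr // JtE.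
  have := ler_wpM2l (ltW tp) Juy; lra.
have h0 := h_smoothness_ge0 u0 tau0.
have : `|t *: y| * h_smoothness X (2 * (t * K) / d) <= t * (d / 8).
  apply: le_trans (ler_wpM2r h0 yK) _.
  have := ler_wpM2l (ltW tp) (ler_wpM2l (ltW K0) (ltW hd)).
  by rewrite mulrA (_ : K * (d / (8 * K)) = d / 8) //; field; rewrite gt_eqF.
have : t * (d / 2) <= t * `|u| by rewrite ler_pM2l.
lra.
Qed.

(** * The Hahn-Banach theorem through minimal sublinear functionals *)

Section Sublinear.
Context {R : realType} {V : lmodType R}.

Definition sublinear (q : V -> R) : Prop :=
  (forall x y, q (x + y) <= q x + q y) /\
  (forall (t : R) x, 0 < t -> q (t *: x) <= t * q x).

Lemma sublinearZ q (t : R) x : sublinear q -> 0 < t -> q (t *: x) = t * q x.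
Proof.
move=> [_ qZ] t0; apply/eqP; rewrite eq_le qZ //=.
have := qZ t^-1 (t *: x); rewrite invr_gt0 => /(_ t0).
by rewrite scalerA mulVf ?gt_eqF // scale1r ler_pdivlMl.
Qed.

Lemma sublinear0 q : sublinear q -> q 0 = 0.
Proof.
by move=> qs; have := sublinearZ 0 qs (ltr0Sn R 1); rewrite scaler0; lra.
Qed.

Lemma sublinearN q x : sublinear q -> - q (- x) <= q x.
Proof.
by move=> qs; have := qs.1 x (- x); rewrite subrr (sublinear0 qs); lra.
Qed.

(** Three sublinear functionals below arise as infima: along a chain, along a
    ray, and as the distance to a subspace.  In the last case the subspace is
    only rational, whence the error e in the homogeneity condition. *)
Lemma sublinear_inf (S : V -> set R) : (forall x, has_inf (S x)) ->
  (forall x y a b, S x a -> S y b -> exists2 c, S (x + y) c & c <= a + b) ->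
  (forall (t : R) x a e, 0 < t -> 0 < e -> S x a ->
     exists2 c, S (t *: x) c & c <= t * a + e) ->
  sublinear (fun x => inf (S x)).
Proof.
move=> Si SD SZ; split=> [x y|t x t0].
  rewrite -lerBlDr; apply: lb_le_inf; first exact: (Si x).1.
  move=> a Sa; rewrite lerBlDr -lerBlDl.
  apply: lb_le_inf; first exact: (Si y).1.
  move=> b Sb; rewrite lerBlDl; have [c Sc cab] := SD _ _ _ _ Sa Sb.
  by apply: le_trans cab; apply: ge_inf => //; exact: (Si (x + y)).2.
rewrite -ler_pdivrMl //; apply: lb_le_inf; first exact: (Si x).1.
move=> a Sa; rewrite ler_pdivrMl //; apply/ler_addgt0Pr => e e0.
have [c Sc cab] := SZ _ _ _ _ t0 e0 Sa.
by apply: le_trans cab; apply: ge_inf => //; exact: (Si (t *: x)).2.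
Qed.

(** The functional is the infimum of q (x + t v) - t q v over t >= 0.  The
    second bound says that it is linear along v as soon as it equals q. *)
Lemma sublinear_descent (q : V -> R) (v : V) : sublinear q ->
  exists2 q', sublinear q' & forall x, q' x <= q x /\ q' x <= q (x + v) - q v.
Proof.
move=> qs; pose S x := [set q (x + t *: v) - t * q v | t in [set t : R | 0 <= t]].
have Sx (t : R) x : 0 <= t -> S x (q (x + t *: v) - t * q v) by exists t.
have qt (t : R) : 0 <= t -> q (t *: v) = t * q v.
  rewrite le_eqVlt => /orP[/eqP<-|t0]; last exact: sublinearZ.
  by rewrite scale0r mul0r sublinear0.
have Si x : has_inf (S x).
  split; first by eexists; exact: (Sx 0).
  exists (- q (- x)) => _ [t t0 <-]; rewrite -(qt t t0).
  have := qs.1 (x + t *: v) (- x).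
  by rewrite addrAC subrr add0r; lra.
exists (fun x => inf (S x)).
  apply: sublinear_inf => // [x y _ _ [s s0 <-] [t t0 <-]|c x _ e c0 e0 [t t0 <-]].
    exists (q (x + y + (s + t) *: v) - (s + t) * q v); first exact/Sx/addr_ge0.
    by have := qs.1 (x + s *: v) (y + t *: v); rewrite addrACA -scalerDl; lra.
  exists (q (c *: x + (c * t) *: v) - (c * t) * q v).
    by apply: Sx; rewrite mulr_ge0 // ltW.
  by have := qs.2 c (x + t *: v) c0; rewrite scalerDr scalerA; lra.
move=> x; split; (apply: le_trans; first (apply: ge_inf; first exact: (Si x).2)).
- exact: (Sx 0).
- by rewrite scale0r mul0r addr0 subr0.
- exact: (Sx 1).
- by rewrite scale1r mul1r.
Qed.

(** Zorn's lemma, the chains being bounded below by their pointwise infima;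
    these are finite since - p (- x) bounds every sublinear functional under p. *)
Lemma minimal_sublinear (p : V -> R) : sublinear p ->
  exists q, [/\ sublinear q, forall x, q x <= p x &
    forall q', sublinear q' -> (forall x, q' x <= q x) -> forall x, q' x = q x].
Proof.
move=> ps; pose T := {q : V -> R | sublinear q /\ forall x, q x <= p x}.
pose leT (s t : T) : bool := `[< forall x, sval t x <= sval s x >].
have [||||[q [qs qp]] qmin] := @Zorn T leT.
- by move=> s; apply/asboolP.
- move=> r s t /asboolP rs /asboolP st; apply/asboolP => x.
  exact: le_trans (st x) (rs x).
- move=> [s sP] [t tP] /asboolP /= st /asboolP /= ts; apply: eq_exist => /=.
  by apply/funext => x; apply/eqP; rewrite eq_le st ts.
- move=> A Atot; have [[s0 As0]|A0] := pselect (A !=set0); last first.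
    by exists (exist _ p (conj ps (fun x => lexx (p x)))) => s As; case: A0; exists s.
  pose S x := [set sval s x | s in A].
  have Si x : has_inf (S x).
    split; first by exists (sval s0 x), s0.
    exists (- p (- x)) => _ [[s [ss sp]] _ <-] /=.
    by apply: le_trans (sublinearN x ss); rewrite lerN2.
  have Sle s x : A s -> inf (S x) <= sval s x.
    by move=> As; apply: ge_inf; [exact: (Si x).2|exists s].
  have Ss : sublinear (fun x => inf (S x)).
    apply: sublinear_inf => // [x y _ _ [s As <-] [t At <-]|c x _ e c0 e0 [s As <-]].
      have [/asboolP st|/asboolP ts] := Atot _ _ As At.
        exists (sval t (x + y)); first by exists t.
        by have := (svalP t).1.1 x y; have := st x; lra.
      exists (sval s (x + y)); first by exists s.
      by have := (svalP s).1.1 x y; have := ts y; lra.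
    exists (sval s (c *: x)); first by exists s.
    by have := (svalP s).1.2 c x c0; lra.
  have Sp x : inf (S x) <= p x := le_trans (Sle s0 x As0) ((svalP s0).2 x).
  exists (exist _ (fun x => inf (S x)) (conj Ss Sp)) => s As.
  by apply/asboolP => x /=; exact: Sle.
exists q; split => // q' q's q'q x.
have q'p y : q' y <= p y := le_trans (q'q y) (qp y).
have le' : leT (exist _ q (conj qs qp)) (exist _ q' (conj q's q'p)) by apply/asboolP.
by have /(congr1 (fun s => sval s x)) := qmin _ le'.
Qed.

(** A minimal sublinear functional coincides with its own descents in all
    directions, hence is additive.  Descending once along v before minimizing
    forces the value p v at v. *)
Lemma hahn_banach_sublinear (p : V -> R) (v : V) : sublinear p ->
  exists f : V -> R, [/\ forall (a : R) x y, f (a *: x + y) = a * f x + f y,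
    forall x, f x <= p x & f v = p v].
Proof.
move=> ps; have [p' p's p'P] := sublinear_descent v ps.
have [q [qs qp' qmin]] := minimal_sublinear p's.
have qD x y : q (x + y) = q x + q y.
  have [q' q's q'P] := sublinear_descent y qs.
  have := qmin q' q's (fun z => (q'P z).1) x.
  by have := (q'P x).2; have := qs.1 x y => ? ? E; apply/eqP; rewrite eq_le; lra.
have qN x : q (- x) = - q x.
  by have := qD x (- x); rewrite subrr sublinear0 //; lra.
exists q; split.
- move=> a x y; rewrite qD; congr (_ + _).
  have [a0|a0|->] := ltgtP a 0; last by rewrite scale0r mul0r sublinear0.
    by rewrite -[in LHS](opprK a) scaleNr qN sublinearZ ?oppr_gt0 // mulNr opprK.
  exact: sublinearZ.
- by move=> x; apply: le_trans (qp' x) (p'P x).1.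
- apply/eqP; rewrite eq_le (le_trans (qp' v) (p'P v).1) /=.
  have := le_trans (qp' (- v)) (p'P (- v)).2.
  by rewrite addNr (sublinear0 ps) qN; lra.
Qed.

End Sublinear.

(** * Weak sequential compactness in reflexive spaces *)

Lemma dual_space_of {R : realType} {V : normedModType R} (f : V -> R) (M : R) :
  (forall (a : R) x y, f (a *: x + y) = a * f x + f y) ->
  (forall x, `|f x| <= M * `|x|) -> exists g : dual_space V, forall x, g x = f x.
Proof.
move=> flin fM.
have fB x y : f (x - y) = f x - f y.
  by have := flin (-1) y x; rewrite scaleN1r addrC; lra.
have fP : f \in @dual_pred R V.
  rewrite inE; split; first by move=> a x y; rewrite flin.
  move=> x; apply/cvgrPdist_le => e e0; near=> y.
  rewrite -fB; apply: le_trans (fM _) _.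
  have M1 : 0 < `|M| + 1 by rewrite ltr_wpDl.
  apply: (@le_trans _ _ ((`|M| + 1) * `|x - y|)).
    by rewrite ler_wpM2r // (le_trans (ler_norm _)) // lerDl.
  rewrite -ler_pdivlMl // mulrC; near: y.
  by apply: cvgr_dist_le => //; rewrite divr_gt0.
by exists (DualSpace fP).
Unshelve. all: by end_near. Qed.

Section Duals.
Context {R : realType} {V : normedModType R}.

Lemma hahn_banach_dual (p : V -> R) (v : V) : sublinear p ->
  (forall x, p x <= `|x|) ->
  exists f : dual_space V, (forall x, f x <= p x) /\ f v = p v.
Proof.
move=> ps pn; have [f [flin fp fv]] := hahn_banach_sublinear v ps.
have fN x : f (- x) = - f x.
  have := flin (-1) x 0; have := flin 1 0 0.
  by rewrite scaleN1r scale1r !addr0; lra.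
have [|g gE] := dual_space_of (M := 1) flin.
  move=> x; rewrite mul1r ler_norml; have := le_trans (fp x) (pn x).
  have := le_trans (fp (- x)) (pn (- x)); rewrite fN normrN.
  by move=> ? ?; apply/andP; split; lra.
by exists g; split => [x|]; rewrite gE.
Qed.

Lemma norm_sublinear : sublinear (fun x : V => `|x|).
Proof.
split; first exact: ler_normD.
by move=> t x t0; rewrite normrZ gtr0_norm.
Qed.

Lemma ultra_bounded_cvg (T : Type) (U : set_system T) (u : T -> R) (M : R) :
  UltraFilter U -> (forall n, `|u n| <= M) -> exists l : R, u n @[n --> U] --> l.
Proof.
move=> UU uM.
have [|l [_ cl]] := @segment_compact R (- M) M (u @ U) _.
  by apply: nearW => n /=; rewrite in_itv /= -ler_norml.
exists l => B lB; have [//|UB] := in_ultra_setVsetC (u @^-1` B) UU.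
by have [x [xB xnB]] := cl (~` B) B UB lB.
Qed.

(** The limits along the ultrafilter define an element of the bidual. *)
Lemma ultra_weak_limit (T : Type) (U : set_system T) (u : T -> V) (M : R) :
  reflexive_space V -> UltraFilter U -> (forall n, `|u n| <= M) ->
  exists x : V, forall f : dual_space V, f (u n) @[n --> U] --> f x.
Proof.
move=> refl UU uM.
have fuM (f : dual_space V) n : `|f (u n)| <= `|f| * M.
  by rewrite (le_trans (dual_apply_le _ _)) // ler_wpM2l.
have /choice[Phi PhiP] (f : dual_space V) : exists l : R, f (u n) @[n --> U] --> l.
  exact: ultra_bounded_cvg (fuM f).
have Philin (a : R) f g : Phi (a *: f + g) = a * Phi f + Phi g.
  have cv : (a *: f + g) (u n) @[n --> U] --> a * Phi f + Phi g.
    by apply: cvgD (PhiP g); apply: cvgM (PhiP f); exact: cvg_cst.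
  exact: (cvg_unique (@Rhausdorff R) (PhiP _) cv).
have PhiM f : `|Phi f| <= M * `|f|.
  rewrite mulrC; apply: (cvgr_to_le (cvg_norm (PhiP f))).
  by apply: nearW => n; exact: fuM.
have [g gE] := dual_space_of Philin PhiM.
have [x xE] := refl g.
by exists x => f; rewrite -xE gE; exact: PhiP.
Qed.

(** Rational combinations are indexed by lists, a countable type: this is what
    allows a single subsequence to be adapted to all of them. *)
Fixpoint rat_comb (u : nat -> V) (c : seq rat) : V :=
  if c is q :: c' then ratr q *: u 0%N + rat_comb (fun n => u n.+1) c' else 0.

Lemma rat_combD u c1 c2 :
  exists c, rat_comb u c = rat_comb u c1 + rat_comb u c2.
Proof.
elim: c1 u c2 => [|q1 c1 IH] u [|q2 c2] /=.
- by exists [::]; rewrite addr0.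
- by exists (q2 :: c2); rewrite add0r.
- by exists (q1 :: c1); rewrite addr0.
have [c cE] := IH (fun n => u n.+1) c2.
by exists (q1 + q2 :: c); rewrite /= cE rmorphD scalerDl addrACA.
Qed.

Lemma rat_combZ u (t e : R) c : 0 < e ->
  exists c', `|t *: rat_comb u c - rat_comb u c'| <= e.
Proof.
elim: c u e => [|q c IH] u e e0 /=.
  by exists [::]; rewrite scaler0 subrr normr0 ltW.
have e20 : 0 < e / 2 by lra.
have [c' c'P] := IH (fun n => u n.+1) _ e20.
pose k := `|u 0%N| + 1; have k0 : 0 < k by rewrite ltr_wpDl.
have ek : 0 < e / 2 / k by rewrite divr_gt0.
have : t * ratr q < t * ratr q + e / 2 / k by rewrite ltrDl.
move=> /rat_in_itvoo[q' /itvP q'P].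
exists (q' :: c') => /=; rewrite scalerDr opprD addrACA scalerA -scalerBl.
apply: le_trans (ler_normD _ _) _.
suff : `|(t * ratr q - ratr q') *: u 0%N| <= e / 2 by lra.
rewrite normrZ; apply: (@le_trans _ _ (e / 2 / k * k)); last by rewrite divfK ?gt_eqF.
apply: ler_pM => //; last by rewrite lerDl.
have l1 : t * ratr q < ratr q' by rewrite q'P.
have l2 : ratr q' < t * ratr q + e / 2 / k by rewrite q'P.
by rewrite ler_norml; apply/andP; split; lra.
Qed.

Lemma rat_comb_unit u i (q : rat) : exists c, rat_comb u c = ratr q *: u i.
Proof.
elim: i u => [|i IH] u; first by exists [:: q]; rewrite /= addr0.
have [c cE] := IH (fun n => u n.+1).
by exists (0 :: c); rewrite /= rmorph0 scale0r add0r cE.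
Qed.

(** A form of Mazur's theorem: a functional that is dominated by the distance
    to the combinations of the u n, and equal to it at x, vanishes at every u n,
    hence also at the weak limit x. *)
Lemma weak_limit_in_span (T : Type) (U : set_system T) (i : T -> nat)
    (u : nat -> V) (x : V) : ProperFilter U ->
  (forall f : dual_space V, f (u (i n)) @[n --> U] --> f x) ->
  forall e : R, 0 < e -> exists c, `|x - rat_comb u c| < e.
Proof.
move=> UU ux.
pose S v := [set `|v - rat_comb u c| | c in [set: seq rat]].
have Sc v c : S v `|v - rat_comb u c| by exists c.
have Si v : has_inf (S v).
  by split; [eexists; exact: (Sc v [::])|exists 0 => _ [c _ <-]].
have S0 v c : inf (S v) <= `|v - rat_comb u c| by apply: ge_inf; [exact: (Si v).2|].
have Ss : sublinear (fun v => inf (S v)).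
  apply: sublinear_inf => // [v w _ _ [c1 _ <-] [c2 _ <-]|t v _ e t0 e0 [c _ <-]].
    have [c cE] := rat_combD u c1 c2.
    by exists `|v + w - rat_comb u c| => //; rewrite cE opprD addrACA ler_normD.
  have [c' c'P] := rat_combZ u t c e0.
  exists `|t *: v - rat_comb u c'| => //.
  apply: le_trans (ler_distD (t *: rat_comb u c) _ _) _.
  by rewrite -scalerBr normrZ gtr0_norm // lerD2l.
have [|f [fS fx]] := hahn_banach_dual x Ss.
  by move=> v; have := S0 v [::]; rewrite subr0.
have fu n : f (u n) = 0.
  have le q : ratr q * f (u n) <= 0.
    have [c cE] := rat_comb_unit u n q.
    have -> : ratr q * f (u n) = f (rat_comb u c) by rewrite cE linearZ.
    by have := le_trans (fS _) (S0 (rat_comb u c) c); rewrite subrr normr0.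
  by have := le 1; have := le (-1); rewrite rmorphN rmorph1; lra.
have fx0 : f x = 0.
  have f0 : f (u (i n)) @[n --> U] --> (0 : R).
    by apply: cvg_near_cst; apply: nearW => n; rewrite fu.
  exact: (cvg_unique (@Rhausdorff R) (ux f) f0).
move=> e e0; have [_ [c _ <-]] := inf_adherent e0 (Si x).
by rewrite -fx fx0 add0r => ?; exists c.
Qed.

Lemma near_all_lt (T : Type) (F : set_system T) (P : nat -> T -> Prop) k :
  Filter F -> (forall j, \forall n \near F, P j n) ->
  \forall n \near F, forall j, (j < k)%N -> P j n.
Proof.
move=> FF FP; elim: k => [|k IH]; first exact: nearW.
apply: filterS (filterI IH (FP k)) => n [nk Pk] j.
by rewrite ltnS leq_eqVlt => /orP[/eqP->|/nk].
Qed.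

(** Smulian's half of the Eberlein-Smulian theorem.  Let x be the weak
    limit of u along an ultrafilter, and let f c norm the vector x - d for every
    rational combination d, of index c, of the u n.  Countably many functionals
    can be made to converge along one subsequence.  Any weak limit y of that
    subsequence along an ultrafilter agrees with x on all the f c, so that x is
    no farther than y from any combination; since y is approximated by them,
    y = x.  As the ultrafilter is arbitrary, the subsequence converges weakly. *)
Lemma weakly_convergent_subsequence (u : nat -> V) (M : R) :
  reflexive_space V -> (forall n, `|u n| <= M) ->
  exists (s : nat -> nat) (x : V), (forall k, (k <= s k)%N) /\
    weak_cvg (u \o s) x.
Proof.
move=> refl uM.
have [U [UU oU]] := @ultraFilterLemma nat \oo _.
have [x xP] := ultra_weak_limit refl UU uM.
have /choice[f fP] (c : seq rat) : exists f : dual_space V,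
    (forall v, f v <= `|v|) /\ f (x - rat_comb u c) = `|x - rat_comb u c|.
  exact: hahn_banach_dual norm_sublinear _.
pose g j := if unpickle j is Some c then f c else 0.
have gf c : g (pickle c) = f c by rewrite /g pickleK.
have /choice[s sP] (k : nat) : exists n, (k <= n)%N /\
    forall j, (j < k)%N -> `|g j x - g j (u n)| < k.+1%:R^-1.
  have k0 : 0 < k.+1%:R^-1 :> R by rewrite invr_gt0 ltr0n.
  apply: (@filter_ex _ U); apply: filterI; first exact/oU/nbhs_infty_ge.
  by apply: near_all_lt => j; move: (xP (g j)) => /cvgrPdist_lt; exact.
have gs j : g j (u (s k)) @[k --> \oo] --> g j x.
  apply/cvgrPdist_le => e e0; near=> k.
  have jk : (j < k)%N by near: k; exact: nbhs_infty_gt.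
  apply: ltW; apply: lt_trans ((sP k).2 j jk) _.
  near: k; exact: (near_infty_natSinv_lt (PosNum e0)).
exists s, x; split=> [k|h]; first exact: (sP k).1.
apply/cvgrPdist_lt => e e0; apply: contrapT => far.
pose E := [set k | e <= `|h x - h (u (s k))|].
have WP : ProperFilter (within E \oo).
  apply: Build_ProperFilter_ex => B EB; apply: contrapT => /forallNP nB.
  apply: far; move: EB; rewrite /within /= => EB; near=> k.
  have kB : E k -> B k by near: k.
  rewrite ltNge; apply/negP => Ek.
  exact: nB k (kB Ek).
have [W [WU EW]] := ultraFilterLemma WP.
have oW : \oo `<=` W by move=> B oB; apply: EW; apply: filterS oB => k Bk _.
have [y yP] := ultra_weak_limit refl WU (fun k => uM (s k)).
have fxy c : f c x = f c y.
  rewrite -gf; apply: (cvg_unique (@Rhausdorff R) _ (yP _)).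
  by move=> B /gs oB; exact: oW.
have xy : x = y.
  apply/eqP; rewrite -subr_eq0 -normr_le0; apply/ler_addgt0Pr => d d0.
  have d20 : 0 < d / 2 by lra.
  have [c yc] := weak_limit_in_span _ yP d20.
  have fE : f c (y - rat_comb u c) = `|x - rat_comb u c|.
    by rewrite -(fP c).2 !linearB /= fxy.
  have := (fP c).1 (y - rat_comb u c); rewrite fE.
  have := ler_distD (rat_comb u c) x y; rewrite (distrC (rat_comb u c) y).
  by rewrite add0r; lra.
have WE : W E by apply: EW; exact: withinT.
have Wn : \forall k \near W, `|h x - h (u (s k))| < e.
  by move: (yP h) => /cvgrPdist_lt; rewrite -xy; exact.
have [k [Ek]] := filter_ex (filterI WE Wn).
by rewrite /= ltNge Ek.
Unshelve. all: by end_near. Qed.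

End Duals.

(** * Inverse uniformly accretive operators *)

Section ModulusFunction.
Context {R : realType} (phi : R -> R -> R).
Hypothesis phi_mod : modulus_function phi.
Hypothesis phi_infty : forall s, 0 < s -> phi s t / t @[t --> +oo] --> +oo.

Lemma modulus_lt (s t u : R) : 0 < s -> 0 <= u -> phi s t < phi s u -> t < u.
Proof.
move=> s0 u0; have [_ _ inc _] := phi_mod; apply: contraTT.
rewrite -!leNgt le_eqVlt => /orP[/eqP->//|ut]; exact/ltW/inc.
Qed.

Lemma modulus_superlinear (s C : R) : 0 < s ->
  exists2 T : R, 0 < T & forall t, T <= t -> C * t < phi s t.
Proof.
move=> s0; have /cvgryPgt/(_ C)[T [_ TP]] := phi_infty s0.
have T1 : T < `|T| + 1 by rewrite ltr_pwDr // ler_norm.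
exists (`|T| + 1) => [|t Tt]; first by rewrite ltr_wpDl.
have := TP t (lt_le_trans T1 Tt); rewrite /= ltr_pdivlMr //.
by apply: lt_le_trans Tt; rewrite ltr_wpDl.
Qed.

Lemma modulus_section_continuous (s b : R) : 0 < s ->
  {within `[0, b], continuous (phi s)}.
Proof.
move=> s0; have [/subspace_continuousP cphi _ _ _] := phi_mod.
apply/subspace_continuousP => t /=; rewrite in_itv /= => /andP[t0 _] B Bt.
have /(_ (conj s0 t0) B Bt) := cphi (s, t).
move=> near_st.
have pair_cvg : (fun v : R => (s, v)) v @[v --> t] --> (s, t).
  exact: (cvg_pair (cvg_cst s) cvg_id).
have near_t : \forall v \near t, 0 < s /\ 0 <= v -> B (phi s v).
  exact: pair_cvg _ near_st.
suff : \forall v \near t, `[0, b]%classic v -> B (phi s v) by [].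
apply: filterS near_t => v Dv /=.
by rewrite in_itv /= => /andP[v0 _]; exact: Dv.
Qed.

Lemma phi_invP (s y : R) : 0 < s -> 0 <= y ->
  0 <= phi_inv phi s y /\ phi s (phi_inv phi s y) = y.
Proof.
move=> s0 y0; apply: (@xgetPex _ 0 [set t | 0 <= t /\ phi s t = y]).
have [T T0 TP] := modulus_superlinear y s0.
pose b := T + 1; have b0 : 0 <= b by rewrite addr_ge0 ?ltW.
have yb : y < phi s b.
  have bT : T <= b by rewrite lerDl.
  have b1 : 1 <= b by rewrite lerDr ltW.
  exact: le_lt_trans (ler_peMr y0 b1) (TP b bT).
have [_ _ _ z0] := phi_mod.
have phi0 : phi s 0 = 0 by apply/z0.
have [|t] := IVT (v := y) b0 (modulus_section_continuous s0).
  by rewrite phi0 ge_min y0 /= le_max (ltW yb) orbT.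
by rewrite in_itv /= => /andP[t0 _] ty; exists t.
Qed.

Lemma le_phi_inv (s t y : R) : 0 < s -> 0 <= t -> phi s t <= y ->
  t <= phi_inv phi s y.
Proof.
move=> s0 t0 ty; have [_ ge0 inc _] := phi_mod.
have [p0 pE] := phi_invP s0 (le_trans (ge0 s t s0 t0) ty).
by rewrite leNgt; apply/negP => /(inc _ _ _ s0 p0); rewrite pE ltNge ty.
Qed.

Lemma phi_inv_cvg0 (s : R) (y : nat -> R) : 0 < s -> (forall n, 0 <= y n) ->
  y n @[n --> \oo] --> 0 -> phi_inv phi s (y n) @[n --> \oo] --> 0.
Proof.
move=> s0 y0 /cvgr0Pnorm_lt yc; apply/cvgr0Pnorm_lt => e e0.
have [_ ge0 _ z0] := phi_mod.
have pe : 0 < phi s e.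
  rewrite lt_neqAle ge0 ?(ltW e0) // andbT eq_sym; apply/eqP => /z0.
  by move=> /(_ s0 (ltW e0)) e00; rewrite e00 ltxx in e0.
apply: filterS (yc _ pe) => n; rewrite ger0_norm // => ye.
have [p0 pE] := phi_invP s0 (y0 n).
by rewrite ger0_norm //; apply: (modulus_lt s0 (ltW e0)); rewrite pE.
Qed.

End ModulusFunction.

Section TameOperators.
Context {R : realType} {X : completeNormedModType R}.
Context (J : X -> dual_space X) (hJ : single_valued_duality J).

(** The properties of an inverse uniformly accretive operator that survive in a
    finite sum of such operators and that yield the solvability of A x + a x = y. *)
Definition tame (A : X -> X) : Prop :=
  [/\ accretive J A,
      forall rho : R, exists2 M : R, 0 < M & forall x, `|x| <= rho -> `|A x| <= M &
      forall rho eps : R, 0 < eps -> exists2 delta : R, 0 < delta &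
        forall x y, `|x| <= rho -> `|y| <= rho -> `|x - y| <= delta ->
          `|A x - A y| <= eps].

(** For x, y in a ball of radius s, the quantity phi s `|A x - A y| is at most
    `|A x - A y| `|x - y|.  Since phi s t grows faster than t, the oscillation of
    A on the ball is bounded by some T; then phi s `|A x - A y| is at most
    T `|x - y|, which is uniform continuity. *)
Lemma inverse_uniformly_accretive_tame (phi : R -> R -> R) (A : X -> X) :
  (forall s, 0 < s -> phi s t / t @[t --> +oo] --> +oo) ->
  inverse_uniformly_accretive J phi A -> tame A.
Proof.
move=> phi_infty [_ phi_mod Aphi]; have [_ ge0 inc z0] := phi_mod.
have osc (rho : R) : exists2 T : R, 0 < T & forall x y, `|x| <= rho -> `|y| <= rho ->
    `|A x - A y| <= T.
  have s0 : 0 < `|rho| + 1 by rewrite ltr_wpDl.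
  have rs (v : X) : `|v| <= rho -> `|v| <= `|rho| + 1.
    by move=> vr; have := ler_norm rho; lra.
  have [T T0 TP] := modulus_superlinear phi_infty (2 * (`|rho| + 1)) s0.
  exists T => // x y xr yr; rewrite leNgt; apply/negP => lt.
  have := TP _ (ltW lt); rewrite ltNge => /negP; apply.
  apply: le_trans (Aphi _ _ _ s0 (rs x xr) (rs y yr)) _.
  apply: le_trans (J_le hJ _ _) _; rewrite ler_wpM2r //.
  by have := ler_normB x y; have := rs x xr; have := rs y yr; lra.
split.
- move=> x y; pose s := `|x| + `|y| + 1.
  have s0 : 0 < s by rewrite ltr_wpDl // addr_ge0.
  have xs : `|x| <= s by rewrite /s -addrA lerDl addr_ge0.
  have ys : `|y| <= s by rewrite /s addrAC lerDr addr_ge0.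
  exact: le_trans (ge0 _ _ s0 (normr_ge0 _)) (Aphi s x y s0 xs ys).
- move=> rho; have [T T0 TP] := osc (`|rho|).
  exists (T + `|A 0|); first by rewrite ltr_wpDr.
  move=> x xr; have := TP x 0 (le_trans xr (ler_norm _)).
  rewrite normr0 => /(_ (normr_ge0 _)).
  by have := ler_normD (A x - A 0) (A 0); rewrite subrK; lra.
- move=> rho eps e0; have [T T0 TP] := osc rho.
  have s0 : 0 < `|rho| + 1 by rewrite ltr_wpDl.
  have rs (v : X) : `|v| <= rho -> `|v| <= `|rho| + 1.
    by move=> vr; have := ler_norm rho; lra.
  have pe : 0 < phi (`|rho| + 1) eps.
    rewrite lt_neqAle ge0 ?(ltW e0) // andbT eq_sym; apply/eqP => /z0.
    by move=> /(_ s0 (ltW e0)) e00; rewrite e00 ltxx in e0.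
  exists (phi (`|rho| + 1) eps / T / 2); first by rewrite !divr_gt0.
  move=> x y xr yr xy; apply: ltW; apply: (modulus_lt phi_mod s0 (ltW e0)).
  apply: le_lt_trans (Aphi _ _ _ s0 (rs x xr) (rs y yr)) _.
  apply: le_lt_trans (J_le hJ _ _) _.
  apply: le_lt_trans (ler_pM _ _ xy (TP x y xr yr)) _ => //.
  by rewrite mulrAC divfK ?gt_eqF //; lra.
Qed.

Lemma tame_sum (I : Type) (s : seq I) (A : I -> X -> X) :
  (forall i, tame (A i)) -> tame (fun x => \sum_(i <- s) A i x).
Proof.
move=> At; elim: s => [|i s [IHa IHb IHu]].
  split=> [x y|rho|rho eps e0].
  - by rewrite !big_nil subrr linear0.
  - by exists 1 => // x _; rewrite big_nil normr0.
  - by exists 1 => // x y _ _ _; rewrite !big_nil subrr normr0 ltW.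
have [Aa Ab Au] := At i.
have sumB x y : \sum_(j <- i :: s) A j x - \sum_(j <- i :: s) A j y =
    (A i x - A i y) + (\sum_(j <- s) A j x - \sum_(j <- s) A j y).
  by rewrite !big_cons opprD addrACA.
split=> [x y|rho|rho eps e0].
- by rewrite sumB linearD addr_ge0 //; [exact: Aa|exact: IHa].
- have [M1 M10 P1] := Ab rho; have [M2 M20 P2] := IHb rho.
  exists (M1 + M2) => [|x xr]; first exact: addr_gt0.
  by rewrite big_cons (le_trans (ler_normD _ _)) // lerD ?P1 ?P2.
- have e20 : 0 < eps / 2 by lra.
  have [d1 d10 P1] := Au rho _ e20; have [d2 d20 P2] := IHu rho _ e20.
  exists (Num.min d1 d2) => [|x y xr yr]; first by rewrite lt_min d10.
  rewrite le_min => /andP[xy1 xy2]; rewrite sumB (le_trans (ler_normD _ _)) //.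
  by have := P1 x y xr yr xy1; have := P2 x y xr yr xy2; lra.
Qed.

(** In particular tame operators are m-accretive, in an arbitrary Banach space. *)
Lemma tame_range (A : X -> X) (a : R) (y : X) : tame A -> 0 < a ->
  exists x, A x + a *: x = y.
Proof.
move=> [Aa Ab Au] a0; pose F x := A x + a *: x - y.
have FB u v : F u - F v = (A u - A v) + a *: (u - v).
  by rewrite /F subrACA subrr subr0 opprD addrACA scalerBr.
have [|||x /eqP] := @expansive_zero R X F a a0.
- move=> u v l l0; apply: (strongly_accretive_expansive hJ) => //.
  rewrite FB linearD /= [J _ (a *: _)]linearZ /= (J_self hJ) lerDr; exact: Aa.
- move=> rho; have [M M0 MP] := Ab rho.
  exists (M + a * `|rho| + `|y|) => [|x xr].
    by rewrite ltr_wpDr // ltr_wpDr // mulr_ge0 // ltW.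
  rewrite (le_trans (ler_normB _ _)) // lerD2r (le_trans (ler_normD _ _)) //.
  rewrite lerD ?MP // normrZ gtr0_norm // ler_pM2l //.
  exact: le_trans xr (ler_norm _).
- move=> rho eps e0; have e20 : 0 < eps / 2 by lra.
  have [d d0 dP] := Au rho _ e20.
  exists (Num.min d (eps / 2 / a)) => [|u v ur vr].
    by rewrite lt_min d0 divr_gt0.
  rewrite le_min => /andP[uv1]; rewrite ler_pdivlMr // => uv2.
  rewrite FB (le_trans (ler_normD _ _)) // normrZ gtr0_norm //.
  by have := dP u v ur vr uv1; lra.
- by rewrite subr_eq0 => /eqP Fx; exists x.
Qed.

Lemma accretive_resolvent_inj (A : X -> X) (a : R) (x y : X) : accretive J A ->
  0 < a -> A x + a *: x = A y + a *: y -> x = y.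
Proof.
move=> Aa a0 /eqP; rewrite -subr_eq0 opprD addrACA -scalerBr => /eqP eq0.
have := linear0 (J (x - y)); rewrite -eq0 linearD /= dualZ (J_self hJ) => E.
have Axy := Aa x y; apply/eqP; rewrite -subr_eq0 -normr_eq0 -sqrf_eq0 eq_le sqr_ge0.
by rewrite andbT -(pmulr_rle0 _ a0); lra.
Qed.

End TameOperators.

(** * The regularized path *)

Section RegularizedPath.
Context {R : realType} {X : completeNormedModType R}.
Context (J : X -> dual_space X) (hJ : single_valued_duality J).
Context (N : nat) (A : 'I_N -> X -> X) (acc : forall i, accretive J (A i)).

Definition regularized (a : R) (z : X) : Prop :=
  \sum_(i < N) A i z + a *: z = 0.

Lemma regularized_sum a z : regularized a z -> \sum_(i < N) A i z = - (a *: z).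
Proof. by move=> /eqP; rewrite addr_eq0 => /eqP. Qed.

Lemma sum_accretive x y :
  0 <= J (x - y) (\sum_(i < N) A i x - \sum_(i < N) A i y).
Proof. by rewrite -sumrB linear_sum sumr_ge0 // => i _; exact: acc. Qed.

Lemma zeros_sum w : common_zeros A w -> \sum_(i < N) A i w = 0.
Proof. by move=> wS; rewrite big1. Qed.

(** The regularized points satisfy the variational inequality which
    characterizes the limit. *)
Lemma regularized_variational a z w : 0 < a -> regularized a z ->
  common_zeros A w -> J (z - w) z <= 0.
Proof.
move=> a0 /regularized_sum zE /zeros_sum wE; have := sum_accretive z w.
by rewrite zE wE subr0 linearN /= dualZ oppr_ge0 pmulr_rle0.
Qed.

Lemma regularized_dist a z w : 0 < a -> regularized a z ->
  common_zeros A w -> `|z - w| ^+ 2 <= J (z - w) (- w).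
Proof.
move=> a0 zE wS; rewrite -(J_self hJ) linearD /= gerDr.
exact: regularized_variational zE wS.
Qed.

Lemma regularized_dist_le a z w : 0 < a -> regularized a z ->
  common_zeros A w -> `|z - w| <= `|w|.
Proof.
move=> a0 zE wS; have [->|u0] := eqVneq (z - w) 0; first by rewrite normr0.
rewrite -(ler_pM2l (_ : 0 < `|z - w|)) ?normr_gt0 //.
have := regularized_dist a0 zE wS; rewrite expr2 => le.
by apply: le_trans le (le_trans (J_le hJ _ _) _); rewrite normrN.
Qed.

Lemma regularized_norm_le a z w : 0 < a -> regularized a z ->
  common_zeros A w -> `|z| <= 2 * `|w|.
Proof.
move=> a0 zE wS; have := regularized_dist_le a0 zE wS.
by have := ler_normD (z - w) w; rewrite subrK; lra.
Qed.

(** The pairings J (z - w) (A i z) are nonnegative and their sum is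
    - a J (z - w) z, which is at most a `|w| ^+ 2; each of them controls
    phi r `|A i z|. *)
Lemma regularized_residual (phi : R -> R -> R) (r a : R) z w i :
  (forall j, inverse_uniformly_accretive J phi (A j)) ->
  0 < r -> 2 * `|w| <= r -> 0 < a -> regularized a z -> common_zeros A w ->
  phi r `|A i z| <= 3 * r ^+ 2 / 2 * a.
Proof.
move=> Aphi r0 wr a0 zE wS; have [_ _ /(_ r z w r0)] := Aphi i.
have zr := le_trans (regularized_norm_le a0 zE wS) wr.
have w0 := normr_ge0 w; have wr' : `|w| <= r by lra.
move=> /(_ zr wr'); rewrite wS subr0 => le; apply: le_trans le _.
have : J (z - w) (A i z) <= J (z - w) (\sum_(j < N) A j z).
  rewrite linear_sum (bigD1 i) //= lerDl sumr_ge0 // => j _.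
  by have := acc j z w; rewrite wS subr0.
move=> le; apply: le_trans le _.
rewrite (regularized_sum zE) -scalerN dualZ mulrC ler_pM2r //.
have := regularized_dist_le a0 zE wS => dw.
have : J (z - w) (- z) <= `|w| * `|w|.
  have -> : - z = - w - (z - w) by rewrite opprB addKr.
  rewrite linearB /= (J_self hJ) lerBlDr.
  apply: le_trans (J_le hJ _ _) _; rewrite normrN.
  by apply: le_trans (ler_wpM2r w0 dw) _; rewrite lerDl exprn_ge0.
have : `|w| * `|w| <= r * r by rewrite ler_pM.
have := mulr_gt0 r0 r0; rewrite expr2; lra.
Qed.

(** Subtract the two equations and test with J (z - y). *)
Lemma regularized_increment a b z y w : 0 < a -> 0 < b -> regularized a z ->
  regularized b y -> common_zeros A w -> `|z - y| <= 2 * `|w| * `|b - a| / a.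
Proof.
move=> a0 b0 zE yE wS; rewrite ler_pdivlMr //.
have [->|u0] := eqVneq (z - y) 0; first by rewrite normr0 mul0r !mulr_ge0.
have n0 : 0 < `|z - y| by rewrite normr_gt0.
have := sum_accretive z y; rewrite (regularized_sum zE) (regularized_sum yE).
have -> : - (a *: z) - - (b *: y) = - (a *: (z - y)) + (b - a) *: y.
  by rewrite scalerBr scalerBl opprB opprK [RHS]addrC subrKA addrC.
rewrite linearD linearN /= !dualZ (J_self hJ) => le.
have : (b - a) * J (z - y) y <= `|b - a| * (`|z - y| * (2 * `|w|)).
  apply: le_trans (ler_norm _) _; rewrite normrM ler_wpM2l //.
  apply: le_trans (dual_apply_le _ _) _; rewrite (J_norm hJ) ler_wpM2l //.
  exact: regularized_norm_le b0 yE wS.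
by move=> le2; rewrite -(ler_pM2l n0); lra.
Qed.

End RegularizedPath.

(** * Limit of the regularized path *)

Section Demiclosedness.
Context {R : realType} {X : normedModType R}.
Context (J : X -> dual_space X) (hJ : single_valued_duality J).

Lemma weak_limit_dual (F : nat -> dual_space X) (f : dual_space X) (c : X) :
  weak_cvg F f -> F k c @[k --> \oo] --> f c.
Proof.
move=> Ff; have [||ev evE] := @dual_space_of R (dual_space X) (fun g => g c) `|c|.
- by [].
- by move=> g; rewrite mulrC dual_apply_le.
by have := Ff ev; rewrite evE; under eq_fun do rewrite evE.
Qed.

Lemma dual_weak_strong (F : nat -> dual_space X) (f : dual_space X) (M : R)
    (u : nat -> X) (c : X) : weak_cvg F f -> (forall k, `|F k| <= M) ->
  u k @[k --> \oo] --> c -> F k (u k) @[k --> \oo] --> f c.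
Proof.
move=> Ff FM uc.
have M0 : 0 <= M := le_trans (normr_ge0 _) (FM 0%N).
have d0 : F k (u k - c) @[k --> \oo] --> 0.
  have M1 : 0 < M + 1 by rewrite ltr_wpDl.
  apply/cvgr0Pnorm_le => e e0; near=> k.
  apply: le_trans (dual_apply_le _ _) _.
  apply: (@le_trans _ _ ((M + 1) * `|u k - c|)).
    by rewrite ler_wpM2r // (le_trans (FM k)) // lerDl.
  rewrite mulrC -ler_pdivlMr // distrC; near: k.
  by move/cvgrPdist_le: uc; apply; rewrite divr_gt0.
rewrite -[f c]add0r.
have -> : (fun k => F k (u k)) = (fun k => F k (u k - c)) \+ (fun k => F k c).
  by apply/funext => k /=; rewrite linearB /= subrK.
exact: cvgD d0 (weak_limit_dual (c := c) Ff).
Unshelve. all: by end_near. Qed.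

Lemma weak_cvgB (u : nat -> X) (l y : X) : weak_cvg u l ->
  weak_cvg (fun k => u k - y) (l - y).
Proof.
move=> ul f; rewrite linearB /=.
have -> : (fun k => f (u k - y)) = (fun k => f (u k)) \- (fun=> f y).
  by apply/funext => k /=; rewrite linearB.
exact: cvgB (ul f) (cvg_cst _).
Qed.

(** In the limit, accretivity gives J (x - y) (B y) <= 0 for every y.  Taking
    y = x - t B x and dividing by t yields `|B x| <= `|B x - B y|, which tends to 0
    with t. *)
Lemma demiclosed_zero (B : X -> X) (v : nat -> X) (x : X) (M : R) :
  accretive J B -> continuous B -> weakly_seq_continuous J -> weak_cvg v x ->
  (forall k, `|v k| <= M) -> B (v k) @[k --> \oo] --> 0 -> B x = 0.
Proof.
move=> acc Bc Jw vx vM Bv.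
have Jle y : J (x - y) (B y) <= 0.
  have JF : weak_cvg (J \o (fun k => v k - y)) (J (x - y)).
    by apply: Jw; exact: weak_cvgB.
  have JM k : `|(J \o (fun k => v k - y)) k| <= M + `|y|.
    by rewrite /= (J_norm hJ) (le_trans (ler_normB _ _)) // lerD2r.
  have BvB : B (v k) - B y @[k --> \oo] --> - B y.
    by rewrite -[X in _ --> X]sub0r; exact: cvgB Bv (cvg_cst _).
  suff : 0 <= J (x - y) (- B y) by rewrite linearN /= oppr_ge0.
  apply: (cvgr_to_ge (dual_weak_strong JF JM BvB)).
  by apply: nearW => k; exact: acc.
set b := B x; apply/eqP; rewrite -normr_le0; apply/ler_addgt0Pr => e e0.
rewrite add0r; have [->|b0] := eqVneq b 0; first by rewrite normr0 ltW.
have nb : 0 < `|b| by rewrite normr_gt0.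
have /cvgrPdist_le/(_ e e0)/nbhs_normP[d /= d0 dP] := Bc x.
have [t [t0 tb]] : exists t : R, 0 < t /\ t * `|b| = d / 2.
  exists (d / 2 / `|b|); split; first by rewrite !divr_gt0.
  by rewrite divfK ?gt_eqF.
have Bte : `|b - B (x - t *: b)| <= e.
  by apply: dP; rewrite /= subKr normrZ gtr0_norm // tb; lra.
have := Jle (x - t *: b); rewrite subKr => Jtb.
have : t * (t * `|b| ^+ 2) <= t * (t * `|b| * `|b - B (x - t *: b)|).
  have -> : t * (t * `|b| ^+ 2) = t * J (t *: b) b.
    by rewrite -[RHS]dualZ (J_self hJ) normrZ gtr0_norm //; ring.
  rewrite ler_pM2l //.
  have -> : J (t *: b) b =
      J (t *: b) (b - B (x - t *: b)) + J (t *: b) (B (x - t *: b)).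
    by rewrite linearB /= subrK.
  apply: (@le_trans _ _ (J (t *: b) (b - B (x - t *: b)))); first by rewrite gerDl.
  by apply: le_trans (J_le hJ _ _) _; rewrite normrZ gtr0_norm.
rewrite ler_pM2l // expr2 mulrA ler_pM2l ?mulr_gt0 // => le.
exact: le_trans le Bte.
Qed.

End Demiclosedness.

Section PathLimit.
Context {R : realType} {X : completeNormedModType R}.
Context (J : X -> dual_space X) (hJ : single_valued_duality J).
Context (N : nat) (A : 'I_N -> X -> X) (At : forall i, tame J (A i)).
Context (Ac : forall i, continuous (A i)).
Context (xhat : X).
Hypothesis hxhat : unique
  (fun z => common_zeros A z /\
            forall w, common_zeros A w -> J (z - w) z <= 0) xhat.
Context (z : nat -> X).
Hypothesis z_var : forall n w, common_zeros A w -> J (z n - w) (z n) <= 0.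
Hypothesis z_res : forall i, A i (z n) @[n --> \oo] --> 0.

Let z_dist n w : common_zeros A w -> `|z n - w| ^+ 2 <= J (z n - w) (- w).
Proof. by move=> wS; rewrite -(J_self hJ) linearD /= gerDr z_var. Qed.

Let z_bounded n : `|z n| <= 2 * `|xhat|.
Proof.
have xS := hxhat.1.1.
suff : `|z n - xhat| <= `|xhat|.
  by have := ler_normD (z n - xhat) xhat; rewrite subrK; lra.
have [->|u0] := eqVneq (z n - xhat) 0; first by rewrite normr0.
rewrite -(ler_pM2l (_ : 0 < `|z n - xhat|)) ?normr_gt0 //.
have := z_dist n xS; rewrite expr2 => le.
by apply: le_trans le (le_trans (J_le hJ _ _) _); rewrite normrN.
Qed.

(** The inequality at z n says that the norm of z n - w does not decrease
    in the direction - z n; this passes to the limit,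
    and at y - w it is read back as a sign of J by the expansion of the norm. *)
Lemma smooth_variational_limit (y w : X) : uniformly_smooth X ->
  z n @[n --> \oo] --> y -> common_zeros A w -> J (y - w) y <= 0.
Proof.
move=> us zy wS; set u := y - w.
have [u0|u0] := eqVneq u 0; first by have := J_le hJ u y; rewrite u0 normr0 mul0r.
have nu : 0 < `|u| by rewrite normr_gt0.
have away (t : R) : 0 < t -> `|u| <= `|u - t *: y|.
  move=> t0; have le n : `|z n - w| <= `|z n - w - t *: z n|.
    set v := z n - w; have [->|v0] := eqVneq v 0; first by rewrite normr0.
    rewrite -(ler_pM2l (_ : 0 < `|v|)) ?normr_gt0 //.
    apply: le_trans (J_le hJ _ _); rewrite linearB /= dualZ (J_self hJ) -expr2.
    by rewrite lerDl oppr_ge0 pmulr_rle0 //; exact: z_var.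
  have c1 : `|z n - w| @[n --> \oo] --> `|u|.
    by apply: cvg_norm; apply: cvgB => //; exact: cvg_cst.
  have c2 : `|z n - w - t *: z n| @[n --> \oo] --> `|u - t *: y|.
    apply: cvg_norm; apply: cvgB; last exact: cvgZr.
    by apply: cvgB => //; exact: cvg_cst.
  by apply: ler_cvg_to c1 c2 _; apply: nearW.
apply/ler_addgt0Pr => e e0; rewrite add0r.
pose K := `|y| + 1; have K0 : 0 < K by rewrite ltr_wpDl.
have d0 : 0 < e / (2 * `|u| * K) by rewrite divr_gt0 // !mulr_gt0.
have [t0 /= t00 t0P] := (cvgr0Pnorm_lt _).1 us _ d0.
pose tau := t0 / 2; have tau0 : 0 < tau by rewrite divr_gt0.
have htau : h_smoothness X tau < e / (2 * `|u| * K).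
  apply: le_lt_trans (ler_norm _) (t0P _ _ _) => //=.
  by rewrite sub0r normrN gtr0_norm // /tau; lra.
pose t := tau * `|u| / K; have tp : 0 < t by rewrite divr_gt0 // mulr_gt0.
have ty : `|t *: - y| <= tau * `|u|.
  rewrite normrZ normrN gtr0_norm // /t mulrAC ler_pdivrMr //.
  by rewrite ler_pM2l ?mulr_gt0 // lerDl.
have := smoothness_norm_le hJ u0 tau0 ty; rewrite scalerN.
have := away t tp; have -> : J u (- (t *: y)) = - (t * J u y).
  by rewrite linearN /= dualZ.
rewrite normrN normrZ gtr0_norm // => l1 l2.
have h0 := h_smoothness_ge0 u0 tau0.
have : t * (J u y / `|u|) <= t * (2 * K * h_smoothness X tau).
  have : t * (`|y| * h_smoothness X tau) <= t * (K * h_smoothness X tau).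
    by rewrite ler_pM2l // ler_wpM2r // lerDl.
  by lra.
rewrite ler_pM2l // ler_pdivrMr // => le; apply: le_trans le _.
move: htau; rewrite ltr_pdivlMr ?mulr_gt0 //; lra.
Qed.

(** If w solves A i w + w = y, then `|z n - w| <= `|z n - y| + `|A i (z n)|: so w
    is an asymptotic center whenever y is, whence w = y and A i y = 0.  As y is a
    common zero, the variational inequality forces the radius to be 0. *)
Lemma path_cvg_uniformly_smooth : uniformly_smooth X -> uniformly_convex X ->
  z n @[n --> \oo] --> xhat.
Proof.
move=> us uc; have [d [y [d0 dmin dy yuniq]]] := asymptotic_center uc z_bounded.
have yS : common_zeros A y.
  move=> i; have [w wE] := tame_range hJ y (At i) ltr01.
  suff wy : w = y.
    by apply: (addIr (1 *: w)); rewrite -{1}wy wE add0r scale1r wy.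
  apply: yuniq => c dc; pose c' := (c + d) / 2.
  have dc' : d < c' by rewrite /c'; lra.
  have e0 : 0 < (c - d) / 2 by lra.
  near=> n.
  have zy : `|z n - y| <= c' by near: n; exact: dy.
  have Az : `|A i (z n)| <= (c - d) / 2.
    by near: n; move: (z_res i) => /cvgr0Pnorm_le; exact.
  have [acc _ _] := At i.
  have := strongly_accretive_expansive (a := 0) hJ (u := z n - w)
    (v := A i (z n) - A i w) ler01.
  rewrite mul0r mulr0 addr0 mul1r scale1r => /(_ (acc _ _)) le.
  apply: le_trans le _.
  have -> : z n - w + (A i (z n) - A i w) = (z n - y) + A i (z n).
    by rewrite -wE scale1r opprD [- A i w - w]addrC !addrA [RHS]addrAC.
  by have := ler_normD (z n - y) (A i (z n)); move: zy; rewrite /c'; lra.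
have d00 : d = 0.
  by apply: (smooth_center_attained hJ us d0 dmin dy) => n; exact: z_dist.
have zy : z n @[n --> \oo] --> y.
  apply/cvgrPdist_le => e e0; have := dy e; rewrite d00 => /(_ e0).
  by apply: filterS => n; rewrite distrC.
have -> : xhat = y; last by [].
by apply: hxhat.2; split => // w wS; exact: smooth_variational_limit us zy wS.
Unshelve. all: by end_near. Qed.

(** Otherwise some subsequence stays away from xhat; a weak limit x of it is a
    common zero, and J (z n - x) (- x), which dominates `|z n - x| ^+ 2, tends to
    0 along it by the weak continuity of J.  So the convergence to x is strong,
    and x satisfies the inequality characterizing xhat. *)
Lemma path_cvg_weakly_continuous : weakly_seq_continuous J -> reflexive_space X ->
  z n @[n --> \oo] --> xhat.
Proof.
move=> Jw refl; apply/cvgrPdist_lt => e e0; apply: contrapT => far.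
have /choice[s0 s0P] (k : nat) : exists n, (k <= n)%N /\ e <= `|xhat - z n|.
  apply: contrapT => /forallNP no; apply: far; exists k => // n /= kn.
  by rewrite ltNge; apply/negP => le; exact: (no n).
have [s1 [x [s1P vx]]] :=
  weakly_convergent_subsequence refl (fun k => z_bounded (s0 k)).
pose s k := s0 (s1 k); pose v k := z (s k).
have sle k : (k <= s k)%N := leq_trans (s1P k) (s0P _).1.
have scvg : s k @[k --> \oo] --> \oo.
  move=> B [n _ nB]; exists n => // k /= nk; apply: nB => /=.
  exact: leq_trans nk (sle k).
have xS : common_zeros A x.
  move=> i; have [acc _ _] := At i.
  apply: (demiclosed_zero hJ acc (@Ac i) Jw vx (fun k => z_bounded (s k))).
  exact: cvg_comp scvg (z_res i).
have Jc w : weak_cvg (J \o (fun k => v k - w)) (J (x - w)).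
  by apply: Jw; exact: weak_cvgB.
have JM w k : `|(J \o (fun k => v k - w)) k| <= 2 * `|xhat| + `|w|.
  by rewrite /= (J_norm hJ) (le_trans (ler_normB _ _)) // lerD2r z_bounded.
have v_x : v k @[k --> \oo] --> x.
  apply/cvgrPdist_lt => d d0.
  have := weak_limit_dual (c := - x) (Jc x); rewrite subrr.
  have -> : J 0 (- x) = 0.
    apply/eqP; rewrite -normr_le0 (le_trans (dual_apply_le _ _)) //.
    by rewrite (J_norm hJ) normr0 mul0r.
  move=> /cvgr0Pnorm_lt /(_ (d ^+ 2)); rewrite exprn_gt0 // => /(_ isT).
  apply: filterS => k /=; move=> lt; rewrite distrC.
  rewrite -(@ltr_pXn2r _ 2) ?nnegrE ?(ltW d0) //.
  apply: le_lt_trans lt; apply: le_trans (ler_norm _).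
  exact: z_dist.
have x_var w : common_zeros A w -> J (x - w) x <= 0.
  move=> wS; apply: (cvgr_to_le (dual_weak_strong (Jc w) (JM w) v_x)).
  by apply: nearW => k; exact: z_var.
have xE : xhat = x by apply: hxhat.2; split.
have [n _ nP] := (cvgrPdist_lt _ _).1 v_x e e0.
have := nP n (leqnn n); rewrite /= -xE ltNge => /negP; apply.
exact: (s0P (s1 n)).2.
Qed.

End PathLimit.

(** * One step of the scheme *)

Section ProximalStep.
Context {R : realType} {X : completeNormedModType R}.
Context (J : X -> dual_space X) (hJ : single_valued_duality J).
Context (N : nat) (hN : (1 <= N)%N) (A : 'I_N -> X -> X).
Context (acc : forall i, accretive J (A i)).
Context (a g : R) (a0 : 0 < a) (g0 : 0 < g) (z x x' : X) (y : 'I_N -> X).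
Hypothesis zE : regularized A a z.
Hypothesis yE : forall i, A i (y i) + (a / N%:R + g) *: y i = g *: x.
Hypothesis x'E : x' = N%:R^-1 *: \sum_(i < N) y i.

Let NR0 : 0 < N%:R :> R. Proof. by rewrite ltr0n. Qed.

(** The residuals of z in the N inner equations.  They sum to 0, which is what
    cancels the first order terms after averaging; and b i is A i z minus the
    mean of the A j z, so that the bound on the A j z carries over to it. *)
Let b i := A i z + (a / N%:R) *: z.

Let sum_b : \sum_(i < N) b i = 0.
Proof.
rewrite big_split /= sumr_const card_ord -scaler_nat scalerA.
by rewrite mulrC divfK ?gt_eqF.
Qed.

Let b_le beta : (forall i, `|A i z| <= beta) -> forall i, `|b i| <= 2 * beta.
Proof.
move=> Ab i; have -> : b i = A i z - N%:R^-1 *: \sum_(j < N) A j z.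
  by rewrite /b (regularized_sum zE) scalerN opprK scalerA mulrC.
apply: le_trans (ler_normB _ _) _; rewrite normrZ gtr0_norm ?invr_gt0 //.
have : N%:R^-1 * `|\sum_(j < N) A j z| <= beta.
  rewrite ler_pdivrMl //; apply: le_trans (ler_norm_sum _ _ _) _.
  apply: (@le_trans _ _ (\sum_(j < N) beta)); first exact: ler_sum.
  by rewrite sumr_const card_ord (mulr_natl _ N).
by have := Ab i; lra.
Qed.

Let resolvent_le i :
  (1 + a / g / N%:R) * `|y i - z| <= `|x - z - g^-1 *: b i|.
Proof.
have gi0 : 0 <= g^-1 by rewrite invr_ge0 ltW.
pose v := (A i (y i) + (a / N%:R) *: y i) - b i.
have := strongly_accretive_expansive (a := a / N%:R) hJ (u := y i - z) (v := v) gi0.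
have -> : y i - z + g^-1 *: v = x - z - g^-1 *: b i.
  have -> : v = g *: (x - y i) - b i.
    by rewrite /v scalerBr -(yE i) scalerDl addrA addrK.
  rewrite scalerBr scalerA mulVf ?gt_eqF // scale1r addrA; congr (_ - _).
  by rewrite addrC subrKA.
rewrite (_ : g^-1 * _ = a / g / N%:R); [apply|by rewrite mulrC mulrAC].
rewrite /v /b opprD addrACA -scalerBr linearD /= dualZ (J_self hJ) lerDr.
exact: acc.
Qed.

Lemma proximal_mean_le :
  (1 + a / g / N%:R) * `|x' - z| <=
  N%:R^-1 * \sum_(i < N) `|x - z - g^-1 *: b i|.
Proof.
have -> : x' - z = N%:R^-1 *: \sum_(i < N) (y i - z).
  rewrite sumrB scalerBr -x'E sumr_const card_ord -(scaler_nat N z) scalerA.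
  by rewrite mulVf ?scale1r // gt_eqF.
rewrite normrZ gtr0_norm ?invr_gt0 // mulrCA ler_pM2l ?invr_gt0 //.
have c0 : 0 <= 1 + a / g / N%:R by rewrite addr_ge0 // !divr_ge0 // ltW.
apply: le_trans (ler_wpM2l c0 (ler_norm_sum _ _ _)) _.
by rewrite mulr_sumr; apply: ler_sum => i _; exact: resolvent_le.
Qed.

Lemma proximal_step_crude beta : (forall i, `|A i z| <= beta) ->
  (1 + a / g / N%:R) * `|x' - z| <= `|x - z| + 2 * (beta / g).
Proof.
move=> Ab; apply: le_trans proximal_mean_le _; rewrite ler_pdivrMl //.
apply: (@le_trans _ _ (\sum_(j < N) (`|x - z| + 2 * (beta / g)))).
  apply: ler_sum => i _; apply: le_trans (ler_normB _ _) _; rewrite lerD2l.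
  rewrite normrZ gtr0_norm ?invr_gt0 // mulrA ler_pdivlMr // mulrC mulrA.
  by rewrite mulfV ?gt_eqF // mul1r; exact: b_le.
by rewrite sumr_const card_ord (mulr_natl _ N).
Qed.

(** Averaging over i cancels the first order terms of the norms of
    x - z - b i / g, because the b i sum to 0; the smoothness remainder is
    evaluated at 1 / g because 2 beta <= `|x - z|. *)
Lemma proximal_step_smooth beta : (forall i, `|A i z| <= beta) ->
  x - z != 0 -> 2 * beta <= `|x - z| ->
  (1 + a / g / N%:R) * `|x' - z| <=
  `|x - z| + 4 * (beta / g) * h_smoothness X g^-1.
Proof.
move=> Ab u0 bu; apply: le_trans proximal_mean_le _; rewrite ler_pdivrMl //.
set u := x - z in u0 bu *; have nu : 0 < `|u| by rewrite normr_gt0.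
have gi0 : 0 < g^-1 by rewrite invr_gt0.
have h0 := h_smoothness_ge0 u0 gi0.
have term i : `|u - g^-1 *: b i| <=
    `|u| + 4 * (beta / g) * h_smoothness X g^-1 - (g^-1 / `|u|) * J u (b i).
  have bi := b_le Ab i.
  have nb : `|- (g^-1 *: b i)| = g^-1 * `|b i| by rewrite normrN normrZ gtr0_norm.
  have le : `|- (g^-1 *: b i)| <= g^-1 * `|u|.
    by rewrite nb ler_pM2l // (le_trans bi).
  have := smoothness_norm_le hJ u0 gi0 le; rewrite nb linearN /= dualZ.
  have : g^-1 * `|b i| * h_smoothness X g^-1 <=
      g^-1 * (2 * beta) * h_smoothness X g^-1.
    by rewrite ler_wpM2r // ler_pM2l.
  lra.
apply: (le_trans (ler_sum _ (fun i _ => term i))).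
rewrite sumrB -mulr_sumr -linear_sum sum_b linear0 mulr0 subr0.
by rewrite sumr_const card_ord (mulr_natl _ N).
Qed.

End ProximalStep.

(** Above the level delta the sequence decreases by kappa c n, and the sum of c
    diverges, so it must go below delta; from then on it cannot exceed 2 delta. *)
Lemma cvg0_of_drift {R : realType} (e c : nat -> R) :
  (forall n, 0 <= e n) ->
  \sum_(1 <= k < n) c k @[n --> \oo] --> +oo ->
  (forall delta, 0 < delta -> exists2 kappa, 0 < kappa &
    \forall n \near \oo, (delta <= e n -> e n.+1 <= e n - kappa * c n) /\
                         (e n < delta -> e n.+1 <= 2 * delta)) ->
  (forall n, 0 <= c n) ->
  e n @[n --> \oo] --> 0.
Proof.
move=> e0 sumc drift c0; apply/cvgr0Pnorm_le => eps eps0.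
have d0 : 0 < eps / 2 by lra.
have [k k0 [n0 _ n0P]] := drift _ d0; set d := eps / 2 in d0 n0P.
pose m := n0.+1.
have stepP n : (m <= n)%N -> (d <= e n -> e n.+1 <= e n - k * c n) /\
    (e n < d -> e n.+1 <= 2 * d) by move=> mn; apply: n0P => /=; exact: ltnW.
have [n1 mn1 en1] : exists2 n1, (m <= n1)%N & e n1 < d.
  apply: contrapT => no.
  have le n : (m <= n)%N -> d <= e n.
    by move=> mn; rewrite leNgt; apply/negP => lt; apply: no; exists n.
  have bound j : e (m + j)%N <= e m - k * \sum_(m <= i < m + j) c i.
    elim: j => [|j IH]; first by rewrite addn0 big_geq // mulr0 subr0.
    rewrite addnS big_nat_recr ?leq_addr //=.
    by have := (stepP _ (leq_addr j m)).1 (le _ (leq_addr j m)); lra.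
  have /cvgryPgt/(_ (\sum_(1 <= i < m) c i + e m / k)) := sumc.
  move=> /(filterI (nbhs_infty_ge m))/filter_ex[n [mn]].
  rewrite /= (big_cat_nat (n := m) (p := n)) //= ltrD2l ltr_pdivrMr // => lt.
  by have := bound (n - m)%N; rewrite subnKC //; have := e0 n; lra.
exists n1 => // n /= n1n; rewrite ger0_norm //.
suff : forall j, e (n1 + j)%N <= 2 * d.
  by move=> /(_ (n - n1)%N); rewrite subnKC // /d; lra.
elim=> [|j IH]; first by rewrite addn0; lra.
have mj : (m <= n1 + j)%N by rewrite (leq_trans mn1) ?leq_addr.
rewrite addnS; have [lo hi] := stepP _ mj.
have [/hi//|/lo le] := ltP (e (n1 + j)%N) d.
by have := mulr_ge0 (ltW k0) (c0 (n1 + j)%N); lra.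
Qed.

(** * Convergence of the scheme *)

Theorem theorem1 (R : realType) (X : completeNormedModType R)
    (J : X -> dual_space X) (hJ : single_valued_duality J)
    (N : nat) (hN : (1 <= N)%N) (A : 'I_N -> X -> X)
    (hS : common_zeros A !=set0) (phi : R -> R -> R)
    (hAB :
      [/\ forall i, inverse_uniformly_accretive J phi (A i),
          weakly_seq_continuous J /\ continuous J,
          smooth_space X, reflexive_space X & possesses_approximation X]
      \/
      [/\ forall i, m_accretive J (A i) /\
                    inverse_uniformly_accretive J phi (A i),
          uniformly_smooth X & uniformly_convex X])
    (xhat : X)
    (hxhat : unique
      (fun z => common_zeros A z /\
                forall w, common_zeros A w -> J (z - w) z <= 0) xhat)
    (alpha gamma : nat -> R)
    (alpha_gt0 : forall n, 0 < alpha n) (gamma_gt0 : forall n, 0 < gamma n)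
    (halpha : alpha n @[n --> \oo] --> 0)
    (hgamma : gamma n @[n --> \oo] --> +oo)
    (hdiff : gamma n * `|alpha n.+1 - alpha n| / alpha n ^+ 2
               @[n --> \oo] --> 0)
    (hsum : \sum_(1 <= k < n) alpha k / gamma k @[n --> \oo] --> +oo)
    (r : R) (r_gt0 : 0 < r) (hr : 2 * `|xhat| <= r)
    (hsmooth : h_smoothness X (gamma n)^-1
                 * phi_inv phi r (3 * r ^+ 2 / 2 * alpha n) / alpha n
               @[n --> \oo] --> 0)
    (hphi : forall s, 0 < s -> phi s t / t @[t --> +oo] --> +oo)
    (x0 : X) :
  exists x : nat -> X,
    unique (iteration A alpha gamma x0) x /\ x n @[n --> \oo] --> xhat.
Proof.
Proof.
have NR0 : 0 < N%:R :> R by rewrite ltr0n.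
have Aphi i : inverse_uniformly_accretive J phi (A i).
  by case: hAB => [[/(_ i)]|[/(_ i)[]]].
have phi_mod : modulus_function phi by case: (Aphi (Ordinal hN)).
have At i : tame J (A i) := inverse_uniformly_accretive_tame hJ hphi (Aphi i).
have Acc i : accretive J (A i) by case: (At i).
have Acont i : continuous (A i) by case: (Aphi i).
have xS : common_zeros A xhat := hxhat.1.1.
have coef n : 0 < alpha n / N%:R + gamma n by rewrite addr_gt0 // divr_gt0.
have /choice[T TE] (p : nat * 'I_N * X) : exists w,
    A p.1.2 w + (alpha p.1.1 / N%:R + gamma p.1.1) *: w = gamma p.1.1 *: p.2.
  exact: (tame_range hJ _ (At _) (coef _)).
pose x := fix x n : X :=
  if n is m.+1 then N%:R^-1 *: \sum_(i < N) T (m, i, x m) else x0.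
have x_iter : iteration A alpha gamma x0 x.
  split=> //; exists (fun n i => T (n, i, x n)) => n; split=> // i.
  exact: (TE (n, i, x n)).
have x_uniq v : iteration A alpha gamma x0 v -> x = v.
  move=> [v0 [y yP]]; apply/funext; elim=> [|n IH]; first by rewrite v0.
  rewrite (yP n).2 /=; congr (_ *: _); apply: eq_bigr => i _.
  apply: (accretive_resolvent_inj hJ (Acc i) (coef n)).
  by rewrite (TE (n, i, x n)) (yP n).1 IH.
exists x; split; first by [].
have sum_tame := tame_sum (index_enum 'I_N) At.
have /choice[z zE] (n : nat) : exists z, regularized A (alpha n) z.
  exact: (tame_range hJ 0 sum_tame (alpha_gt0 n)).
pose beta n := phi_inv phi r (3 * r ^+ 2 / 2 * alpha n).
have r2 : 0 < 3 * r ^+ 2 / 2 by rewrite divr_gt0 // mulr_gt0 // exprn_gt0.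
have z_beta n i : `|A i (z n)| <= beta n.
  apply: le_phi_inv => //.
  exact: (regularized_residual hJ Acc _ Aphi r_gt0 hr (alpha_gt0 n) (zE n) xS).
have beta0 : beta n @[n --> \oo] --> 0.
  apply: phi_inv_cvg0 => // [n|]; first by rewrite mulr_ge0 ?ltW.
  by rewrite -(mulr0 (3 * r ^+ 2 / 2)); apply: cvgM => //; exact: cvg_cst.
have z_res i : A i (z n) @[n --> \oo] --> 0.
  apply/cvgr0Pnorm_le => e e0; move/cvgr0Pnorm_le: beta0 => /(_ e e0).
  by apply: filterS => n; apply: le_trans; apply: le_trans (ler_norm _).
have z_var n w : common_zeros A w -> J (z n - w) (z n) <= 0.
  exact: (regularized_variational Acc (alpha_gt0 n) (zE n)).
have z_cvg : z n @[n --> \oo] --> xhat.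
  case: hAB => [[_ [Jw _] _ refl _]|[_ us uc]].
    exact: (path_cvg_weakly_continuous hJ At Acont hxhat z_var z_res Jw refl).
  exact: (path_cvg_uniformly_smooth hJ At hxhat z_var z_res us uc).
pose c n := alpha n / gamma n.
have c_gt0 n : 0 < c n by rewrite divr_gt0.
pose eta n := 2 * `|xhat| * `|alpha n.+1 - alpha n| / alpha n.
have eta_c : eta n / c n @[n --> \oo] --> 0.
  rewrite -(mulr0 (2 * `|xhat|)).
  have -> : (fun n => eta n / c n) = (fun n => (2 * `|xhat|) *
      (gamma n * `|alpha n.+1 - alpha n| / alpha n ^+ 2)).
    by apply/funext => n; rewrite /eta /c; field; rewrite !gt_eqF.
  by apply: cvgM => //; exact: cvg_cst.
pose theta n := h_smoothness X (gamma n)^-1 * beta n / alpha n.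
suff e_cvg : `|x n - z n| @[n --> \oo] --> 0.
  have xz : x n - z n @[n --> \oo] --> 0.
    by apply/cvgr0Pnorm_le => e e0; move/cvgr0Pnorm_le: e_cvg => /(_ e e0);
       apply: filterS => n; rewrite normr_id.
  have xE : x = (fun n => x n - z n) \+ z by apply/funext => n /=; rewrite subrK.
  by rewrite xE -[xhat]add0r; exact: cvgD xz z_cvg.
apply: (@cvg0_of_drift _ _ c) => // [delta d0|n]; last exact/ltW/c_gt0.
(* A step gains delta c n / (2 N), that is 4 k c n, through the factor
   1 + c n / N, and loses at most k c n to the smoothness remainder and k c n to
   the motion of the path. *)
pose k := delta / (8 * N%:R).
have k0 : 0 < k by rewrite divr_gt0 // mulr_gt0.
have kd : k <= delta / 8.
  rewrite ler_pdivrMr ?mulr_gt0 // mulrA divfK ?gt_eqF //.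
  by rewrite ler_peMr ?(ltW d0) // ler1n.
exists k => //; near=> n.
have an1 : alpha n <= 1.
  by rewrite -[leLHS]gtr0_norm //; near: n; move/cvgr0Pnorm_le: halpha; apply.
have gn1 : 1 <= gamma n by near: n; move/cvgryPge: hgamma; apply.
have c1 : c n <= 1 by rewrite ler_pdivrMr // mul1r (le_trans an1).
have bn : `|beta n| <= delta / 8.
  by near: n; move/cvgr0Pnorm_le: beta0; apply; lra.
have th : `|theta n| <= k / 4.
  by near: n; move/cvgr0Pnorm_le: hsmooth; apply; lra.
have et : `|eta n / c n| <= k.
  by near: n; move/cvgr0Pnorm_le: eta_c; apply.
have eta_le : eta n <= k * c n.
  by rewrite -ler_pdivrMr // (le_trans (ler_norm _)).
have kc : k * c n <= k by rewrite ger_pMr.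
have bgn : beta n / gamma n <= delta / 8.
  rewrite ler_pdivrMr //; have := le_trans (ler_norm _) bn.
  have : delta / 8 <= delta / 8 * gamma n by rewrite ler_peMr //; lra.
  lra.
set p := `|x n.+1 - z n|.
have ep : `|x n.+1 - z n.+1| <= p + eta n.
  have := ler_distD (z n) (x n.+1) (z n.+1).
  have := regularized_increment hJ Acc (alpha_gt0 n) (alpha_gt0 n.+1)
    (zE n) (zE n.+1) xS.
  by rewrite -/(eta n) /p; lra.
have yE i := TE (n, i, x n).
have cp : (1 + c n / N%:R) * p = p + p * (c n / N%:R) by ring.
have cN0 : 0 <= c n / N%:R by rewrite divr_ge0 // ltW.
have pc0 : 0 <= p * (c n / N%:R) by rewrite mulr_ge0 // /p normr_ge0.
split=> [de|ed].
  have u0 : x n - z n != 0 by rewrite -normr_gt0; lra.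
  have bu : 2 * beta n <= `|x n - z n| by have := le_trans (ler_norm _) bn; lra.
  have := proximal_step_smooth hJ hN Acc (alpha_gt0 n) (gamma_gt0 n) (zE n)
    yE (erefl (x n.+1)) (z_beta n) u0 bu.
  rewrite -/(c n) -/p cp.
  have -> : 4 * (beta n / gamma n) * h_smoothness X (gamma n)^-1 =
      c n * (4 * theta n) by rewrite /c /theta; field; rewrite !gt_eqF.
  have : c n * (4 * theta n) <= c n * k.
    by rewrite ler_pM2l //; have := le_trans (ler_norm _) th; lra.
  (* If p is below delta / 2, the distance has dropped by more than 4 k c n. *)
  have [ps|pl] := ltP p (delta / 2); first by lra.
  have : delta / 2 * (c n / N%:R) <= p * (c n / N%:R) by rewrite ler_wpM2r.
  have -> : delta / 2 * (c n / N%:R) = 4 * (k * c n).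
    by rewrite /k; field; rewrite gt_eqF.
  by lra.
have := proximal_step_crude hJ hN Acc (alpha_gt0 n) (gamma_gt0 n) (zE n)
  yE (erefl (x n.+1)) (z_beta n).
by rewrite -/(c n) -/p cp; lra.
Unshelve. all: by end_near. Qed.
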